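(* Let $k$ be a field, let $G$ be a group, let $\mathcal{C}$ be a $G$-$k$-category with free action of $G$, and let $\mathcal{C}\to\mathcal{C}/G$ be the corresponding Galois covering. If the invariants functor $M\mapsto M^G$ on $kG$-modules is exact, there is a canonical injective morphism $$HH^*(\mathcal{C})^G\hookrightarrow HH^*(\mathcal{C}/G)$$ which splits canonically.
   Context: A $k$-category is a small category enriched over $k$-vector spaces; the space of morphisms from $x$ to $y$ is denoted ${}_y\mathcal{C}_x$ and the set of objects $\mathcal{C}_0$. A $G$-$k$-category is a $k$-category with an action of $G$ by $k$-isomorphisms of $\mathcal{C}$: $G$ acts on $\mathcal{C}_0$, and each $s\in G$ gives $k$-linear maps ${}_y\mathcal{C}_x\to{}_{sy}\mathcal{C}_{sx}$, $f\mapsto sf$, compatible with composition and identities, with $t(sf)=(ts)f$. The action is free if it is free on objects. For a $kG$-module $M$, $M_G=M/\langle sm-m\mid m\in M,s\in G\rangle$ and $M^G=\{m\in M\mid sm=m\ \text{for all } s\in G\}$. For a free action, the quotient category $\mathcal{C}/G$ has set of objects the set of orbits $\mathcal{C}_0/G$, and morphisms ${}_\beta(\mathcal{C}/G)_\alpha=\left(\bigoplus_{x\in\alpha,\,y\in\beta}{}_y\mathcal{C}_x\right)_G$. For $g\in{}_z\mathcal{C}_{y'}$ and $f\in{}_y\mathcal{C}_x$ with $y,y'$ in the same orbit, let $s\in G$ be the unique element with $sy=y'$; the composite of the classes of $g$ and $f$ is the class of $g\,(sf)$. The Galois covering is the canonical projection functor $\mathcal{C}\to\mathcal{C}/G$.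 The Hochschild-Mitchell cohomology $HH^*(\mathcal{C})$ of a $k$-category is the cohomology of the cochain complex $C^\bullet(\mathcal{C})$ with $C^0(\mathcal{C})=\prod_{x\in\mathcal{C}_0}{}_x\mathcal{C}_x$ and, for $n>0$, $$C^n(\mathcal{C})=\prod_{x_{n+1},\dots,x_1\in\mathcal{C}_0}\mathrm{Hom}_k\left({}_{x_{n+1}}\mathcal{C}_{x_n}\otimes\cdots\otimes{}_{x_2}\mathcal{C}_{x_1},\ {}_{x_{n+1}}\mathcal{C}_{x_1}\right),$$ with the usual Hochschild coboundary $$(d\varphi)(f_{n+1}\otimes\cdots\otimes f_1)=(-1)^{n+1}f_{n+1}\varphi(f_n\otimes\cdots\otimes f_1)+\sum_{i=1}^n(-1)^i\varphi(f_{n+1}\otimes\cdots\otimes f_{i+1}f_i\otimes\cdots\otimes f_1)+\varphi(f_{n+1}\otimes\cdots\otimes f_2)f_1.$$ If $\mathcal{C}$ is a $G$-$k$-category, $G$ acts on $C^\bullet(\mathcal{C})$, hence on $HH^*(\mathcal{C})$: for $n>0$, the component of $s.\varphi$ at $(sx_{n+1},\dots,sx_1)$ is $f_n\otimes\cdots\otimes f_1\mapsto s[\varphi_{(x_{n+1},\dots,x_1)}(s^{-1}f_n\otimes\cdots\otimes s^{-1}f_1)]$, and for $n=0$ the component of $s.\varphi$ at $sx$ is $s\varphi_x$. *)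

(* Defs.v *)
From HB Require Import structures.
From mathcomp Require Import all_boot all_algebra.
From mathcomp Require Import boolp classical_sets fsbigop.

Set Implicit Arguments.
Unset Strict Implicit.
Unset Printing Implicit Defensive.

Import GRing.Theory.
Local Open Scope ring_scope.
Local Open Scope quotient_scope.

(** * Vector spaces: products, subspaces, quotients *)

Section DependentProduct.
Variables (k : fieldType) (I : Type) (M : I -> lmodType k).

Definition dep_prod : Type := forall i, M i.

HB.instance Definition _ := gen_eqMixin dep_prod.
HB.instance Definition _ := gen_choiceMixin dep_prod.

Definition dprod_zero : dep_prod := fun=> 0.
Definition dprod_opp (f : dep_prod) : dep_prod := fun i => - f i.
Definition dprod_add (f g : dep_prod) : dep_prod := fun i => f i + g i.
Definition dprod_scale (a : k) (f : dep_prod) : dep_prod := fun i => a *: f i.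

Fact dprod_addA : associative dprod_add.
Proof. by move=> f g h; apply: functional_extensionality_dep => i; apply: addrA. Qed.
Fact dprod_addC : commutative dprod_add.
Proof. by move=> f g; apply: functional_extensionality_dep => i; apply: addrC. Qed.
Fact dprod_add0 : left_id dprod_zero dprod_add.
Proof. by move=> f; apply: functional_extensionality_dep => i; apply: add0r. Qed.
Fact dprod_addN : left_inverse dprod_zero dprod_opp dprod_add.
Proof. by move=> f; apply: functional_extensionality_dep => i; apply: addNr. Qed.

HB.instance Definition _ :=
  GRing.isZmodule.Build dep_prod dprod_addA dprod_addC dprod_add0 dprod_addN.

Fact dprod_scaleA a b f : dprod_scale a (dprod_scale b f) = dprod_scale (a * b) f.
Proof. by apply: functional_extensionality_dep => i; apply: scalerA. Qed.
Fact dprod_scale1 : left_id 1 dprod_scale.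
Proof. by move=> f; apply: functional_extensionality_dep => i; apply: scale1r. Qed.
Fact dprod_scaleDr : right_distributive dprod_scale +%R.
Proof. by move=> a f g; apply: functional_extensionality_dep => i; apply: scalerDr. Qed.
Fact dprod_scaleDl f : {morph dprod_scale^~ f : a b / a + b}.
Proof. by move=> a b; apply: functional_extensionality_dep => i; apply: scalerDl. Qed.

HB.instance Definition _ := GRing.Zmodule_isLmodule.Build k dep_prod
  dprod_scaleA dprod_scale1 dprod_scaleDr dprod_scaleDl.

Lemma dprodP (f g : dep_prod) : (forall i, f i = g i) -> f = g.
Proof. exact: functional_extensionality_dep. Qed.

End DependentProduct.

Section SubQuotient.
Variables (k : fieldType) (V : lmodType k).

Definition subspace (S : submodClosed V) : Type := {v : V | v \in S}.

Section Instances.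
Variable S : submodClosed V.
HB.instance Definition _ := SubChoice.on (subspace S).
HB.instance Definition _ := [SubChoice_isSubLmodule of subspace S by <:].
End Instances.

Lemma subspace_valP (S : submodClosed V) (a : k) (u v : subspace S) :
  val (a *: u + v) = a *: val u + val v.
Proof. by []. Qed.

Section ZmodClosed.
Variable S : submodClosed V.
Definition zmod_pred : {pred V} := fun v => v \in S.
Fact zmod_pred_closed : zmod_closed zmod_pred.
Proof.
split=> [|u v Su Sv]; first exact: (rpred0 S).
by rewrite -[- v]scaleN1r; apply: (rpredD (S := S)) => //; exact: (rpredZ (s := S)).
Qed.
HB.instance Definition _ := GRing.isZmodClosed.Build V zmod_pred zmod_pred_closed.
End ZmodClosed.

Definition quot_space (S : submodClosed V) : Type := Quotient.quot (zmod_pred S).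

Section Instances.
Variable S : submodClosed V.
HB.instance Definition _ := EqQuotient.on (quot_space S).
HB.instance Definition _ := GRing.Zmodule.on (quot_space S).
Local Notation Q := (quot_space S).

Definition cls (v : V) : Q := \pi_Q v.

Lemma clsK (u : Q) : cls (repr u) = u.
Proof. exact: reprK. Qed.

Lemma cls_eq (v w : V) : cls v = cls w <-> v - w \in S.
Proof.
rewrite /cls; split=> [/eqP e|e]; [|apply/eqP];
  by move: e; rewrite -(Quotient.idealrBE (zmod_pred S)).
Qed.

Lemma repr_cls (v : V) : repr (cls v) - v \in S.
Proof. by apply/cls_eq; rewrite clsK. Qed.

Definition quot_scale (a : k) (u : Q) : Q := cls (a *: repr u).

Lemma clsD v w : cls (v + w) = cls v + cls w.
Proof. by rewrite /cls (Quotient.pi_add (zmod_pred S)). Qed.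

Lemma quot_scale_cls a v : quot_scale a (cls v) = cls (a *: v).
Proof. by apply/cls_eq; rewrite -scalerBr rpredZ ?repr_cls. Qed.

Fact quot_scaleA a b u :
  quot_scale a (quot_scale b u) = quot_scale (a * b) u.
Proof. by rewrite -(clsK u) !quot_scale_cls scalerA. Qed.
Fact quot_scale1 : left_id 1 quot_scale.
Proof. by move=> u; rewrite -(clsK u) quot_scale_cls scale1r. Qed.
Fact quot_scaleDr : right_distributive quot_scale +%R.
Proof.
by move=> a u v; rewrite -(clsK u) -(clsK v) -clsD !quot_scale_cls scalerDr clsD.
Qed.
Fact quot_scaleDl u : {morph quot_scale^~ u : a b / a + b}.
Proof. by move=> a b; rewrite -(clsK u) !quot_scale_cls scalerDl clsD. Qed.

HB.instance Definition _ := GRing.Zmodule_isLmodule.Build k Q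
  quot_scaleA quot_scale1 quot_scaleDr quot_scaleDl.

Fact cls_linear : linear cls.
Proof. by move=> a v w; rewrite clsD -quot_scale_cls. Qed.
HB.instance Definition _ := GRing.isLinear.Build k V Q *:%R cls cls_linear.

End Instances.

Definition linspan (A : V -> Prop) : {pred V} := fun v =>
  `[< exists2 l : seq (k * V),
        (forall c, c \in l -> A c.2) & v = \sum_(c <- l) c.1 *: c.2 >].

Fact span_submod (A : V -> Prop) : submod_closed (linspan A).
Proof.
split=> [|a u v /asboolP[lu Au ->] /asboolP[lv Av ->]]; apply/asboolP.
  by exists [::]; rewrite ?big_nil.
exists ([seq (a * c.1, c.2) | c <- lu] ++ lv).
  move=> c; rewrite mem_cat => /orP[/mapP[c' c'lu ->] /=|]; [exact: Au|exact: Av].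
rewrite big_cat big_map /= scaler_sumr; congr (_ + _).
by apply: eq_bigr => c _; rewrite scalerA.
Qed.
HB.instance Definition _ (A : V -> Prop) :=
  GRing.isSubmodClosed.Build k V (linspan A) (span_submod A).

End SubQuotient.

Arguments cls {k V S} v.

(** * kG-modules, invariants and coinvariants *)

Record gmodule (k : fieldType) (G : groupType) := GModule {
  gmod_space :> lmodType k;
  gmod_act : G -> gmod_space -> gmod_space;
  gmod_act_linear : forall s, linear (gmod_act s);
  gmod_act1 : forall m, gmod_act 1%g m = m;
  gmod_actM : forall s t m, gmod_act (s * t)%g m = gmod_act s (gmod_act t m)
}.

Section GModule.
Variables (k : fieldType) (G : groupType).
Implicit Types M N P : gmodule k G.

Section Instances.
Variables (M : gmodule k G) (s : G).
HB.instance Definition _ :=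
  GRing.isLinear.Build k M M *:%R (@gmod_act k G M s) (@gmod_act_linear k G M s).
End Instances.

Definition inv_pred M : {pred M} := fun m => `[< forall s, gmod_act s m = m >].
Arguments inv_pred : clear implicits.

Fact inv_submod M : submod_closed (inv_pred M).
Proof.
split=> [|a u v /asboolP iu /asboolP iv]; apply/asboolP=> s.
  exact: raddf0.
by rewrite gmod_act_linear iu iv.
Qed.
HB.instance Definition _ M :=
  GRing.isSubmodClosed.Build k M (inv_pred M) (@inv_submod M).

(* M^G *)
Definition invariants M : lmodType k := subspace (inv_pred M).

(* M_G *)
Definition coinvariants M : lmodType k :=
  quot_space (linspan (fun v : M => exists s m, v = gmod_act s m - m)).

Definition equivariant M N (f : M -> N) : Prop :=
  forall s m, f (gmod_act s m) = gmod_act s (f m).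

Fact inv_map_subproof M N (f : M -> N) (fG : equivariant f) (m : invariants M) :
  f (val m) \in inv_pred N.
Proof.
by apply/asboolP=> s; case: m => m /= /asboolP im; rewrite -fG im.
Qed.

(* the invariants functor on morphisms *)
Definition inv_map M N (f : M -> N) (fG : equivariant f)
  (m : invariants M) : invariants N := Sub (f (val m)) (inv_map_subproof fG m).

Definition short_exact (A B D : lmodType k) (f : A -> B) (g : B -> D) : Prop :=
  [/\ injective f, (forall b, g b = 0 <-> exists a, f a = b)
    & (forall d, exists b, g b = d)].

End GModule.

Definition invariants_exact (k : fieldType) (G : groupType) : Prop :=
  forall (M N P : gmodule k G) (f : {linear M -> N}) (g : {linear N -> P})
         (fG : equivariant f) (gG : equivariant g),
    short_exact f g -> short_exact (inv_map fG) (inv_map gG).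

(** * Direct sums *)

Section DirectSum.
Variables (k : fieldType) (I : choiceType) (M : I -> lmodType k).

Definition finsupp_pred : {pred dep_prod M} := fun m =>
  `[< exists l : seq I, forall i, i \notin l -> m i = 0 >].

Fact finsupp_submod : submod_closed finsupp_pred.
Proof.
split=> [|a u v /asboolP[lu hu] /asboolP[lv hv]]; apply/asboolP.
  by exists [::].
exists (lu ++ lv) => i; rewrite mem_cat negb_or => /andP[iu iv].
by rewrite [LHS](_ : _ = a *: u i + v i) // hu // hv // scaler0 addr0.
Qed.
HB.instance Definition _ :=
  GRing.isSubmodClosed.Build k (dep_prod M) finsupp_pred finsupp_submod.

Definition dsum : lmodType k := subspace finsupp_pred.

Definition dsum_inj_fun (i : I) (v : M i) : dep_prod M := fun j =>
  match i =P j with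
  | ReflectT e => ecast j (M j) e v
  | ReflectF _ => 0
  end.

Lemma dsum_inj_funE i (v : M i) : dsum_inj_fun v i = v.
Proof.
by rewrite /dsum_inj_fun; case: eqP => // e; rewrite (eq_axiomK e).
Qed.

Lemma dsum_inj_fun0 i j (v : M i) : i != j -> dsum_inj_fun v j = 0.
Proof. by rewrite /dsum_inj_fun; case: eqP. Qed.

Fact dsum_inj_subproof i (v : M i) : dsum_inj_fun v \in finsupp_pred.
Proof.
apply/asboolP; exists [:: i] => j; rewrite inE eq_sym => ij.
exact: dsum_inj_fun0.
Qed.

Definition dsum_inj i (v : M i) : dsum := Sub (dsum_inj_fun v) (dsum_inj_subproof v).

Lemma dsum_supp (m : dsum) : exists2 l : seq I, uniq l & forall i, i \notin l -> val m i = 0.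
Proof.
case: m => m /= /asboolP[l hl]; exists (undup l); first exact: undup_uniq.
by move=> i; rewrite mem_undup; apply: hl.
Qed.

Lemma dsumP (m n : dsum) : (forall i, val m i = val n i) -> m = n.
Proof. by move=> mn; apply/val_inj/dprodP. Qed.

Lemma val_dsum_add (m n : dsum) i : val (m + n) i = val m i + val n i.
Proof. by []. Qed.

Lemma val_dsum_sum (T : Type) (l : seq T) (F : T -> dsum) i :
  val (\sum_(t <- l) F t) i = \sum_(t <- l) val (F t) i.
Proof. by elim/big_rec2: _ => // t u v _ <-. Qed.

Lemma dsum_decomp (m : dsum) (l : seq I) : uniq l ->
  (forall i, i \notin l -> val m i = 0) ->
  m = \sum_(i <- l) dsum_inj (val m i).
Proof.
move=> ul hl; apply: dsumP => i; rewrite val_dsum_sum.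
have [il|il] := boolP (i \in l); last first.
  rewrite hl // big1_seq // => j /= jl.
  by rewrite dsum_inj_fun0 //; apply: contraNneq il => <-.
rewrite (bigD1_seq i) //= dsum_inj_funE big1 ?addr0 // => j ji.
by rewrite dsum_inj_fun0.
Qed.

(* the linear extension of a family of linear maps *)
Definition dsum_ext (V : lmodType k) (F : forall i, M i -> V) (m : dsum) : V :=
  \sum_(i \in [set: I]) @F i (val m i).

Section Ext.
Variables (V : lmodType k) (F : forall i, M i -> V).
Hypothesis FL : forall i, linear (@F i).

Let F0 i : @F i 0 = 0.
Proof. by move: (@FL i (-1) 0 0); rewrite !scaleN1r oppr0 addr0 addNr. Qed.

Lemma dsum_extE (m : dsum) (l : seq I) : uniq l ->
  (forall i, i \notin l -> val m i = 0) -> dsum_ext F m = \sum_(i <- l) F (val m i).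
Proof.
move=> ul hl; rewrite /dsum_ext (fsbigE l) //.
  by apply: eq_bigl => i; rewrite in_setT.
by move=> i _ il; rewrite hl // F0.
Qed.

Lemma dsum_ext_linear : linear (dsum_ext F).
Proof.
move=> a u v; have [lu ulu hu] := dsum_supp u; have [lv ulv hv] := dsum_supp v.
pose l := undup (lu ++ lv); have ul : uniq l by apply: undup_uniq.
have hu' i : i \notin l -> val u i = 0.
  by rewrite mem_undup mem_cat negb_or => /andP[iu _]; apply: hu.
have hv' i : i \notin l -> val v i = 0.
  by rewrite mem_undup mem_cat negb_or => /andP[_ iv]; apply: hv.
rewrite (dsum_extE ul hu') (dsum_extE ul hv') (@dsum_extE _ l) //; last first.
  by move=> i il; rewrite [LHS](_ : _ = a *: val u i + val v i) // hu' // hv' // scaler0 addr0.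
by rewrite scaler_sumr -big_split; apply: eq_bigr => i _; exact: FL.
Qed.

Lemma dsum_ext_inj i (v : M i) : dsum_ext F (dsum_inj v) = F v.
Proof.
rewrite (@dsum_extE _ [:: i]) ?big_seq1 ?dsum_inj_funE //.
  by rewrite /= dsum_inj_funE.
by move=> j; rewrite inE eq_sym => ij; apply: dsum_inj_fun0.
Qed.

End Ext.

Lemma dsum_inj_linear i : linear (@dsum_inj i).
Proof.
move=> a u v; apply: dsumP => j.
rewrite [RHS](_ : _ = a *: dsum_inj_fun u j + dsum_inj_fun v j) //=.
have [<-|ij] := eqVneq i j; first by rewrite !dsum_inj_funE.
by rewrite !dsum_inj_fun0 // scaler0 addr0.
Qed.

End DirectSum.

Arguments finsupp_pred {k I} M.

(** * k-categories and G-k-categories *)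

(* [mor y x] is the space of morphisms from [x] to [y]. *)
Record kcat (k : fieldType) := KCat {
  ob :> choiceType;
  mor : ob -> ob -> lmodType k;
  mcomp : forall z y x : ob, mor z y -> mor y x -> mor z x;
  mid : forall x : ob, mor x x;
  mcomp_linear_l : forall (z y x : ob) (f : mor y x),
    linear (fun g : mor z y => mcomp g f);
  mcomp_linear_r : forall (z y x : ob) (g : mor z y),
    linear (fun f : mor y x => mcomp g f);
  mcompA : forall (w z y x : ob) (h : mor w z) (g : mor z y) (f : mor y x),
    mcomp h (mcomp g f) = mcomp (mcomp h g) f;
  mcomp_idl : forall (y x : ob) (f : mor y x), mcomp (mid y) f = f;
  mcomp_idr : forall (y x : ob) (f : mor y x), mcomp f (mid x) = f
}.

Definition hcast (k : fieldType) (C : kcat k) (y x y' x' : C)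
    (ey : y = y') (ex : x = x') (f : mor y x) : mor y' x' :=
  ecast z (mor z x') ey (ecast z (mor y z) ex f).

Record gkcat (k : fieldType) (G : groupType) := GKCat {
  gkcat_kcat :> kcat k;
  gob : G -> gkcat_kcat -> gkcat_kcat;
  gob1 : forall x, gob 1%g x = x;
  gobM : forall s t x, gob (s * t)%g x = gob s (gob t x);
  ghom : forall (s : G) (y x : gkcat_kcat), mor y x -> mor (gob s y) (gob s x);
  ghom_linear : forall s y x, linear (@ghom s y x);
  ghom1 : forall y x (f : mor y x), hcast (gob1 y) (gob1 x) (ghom 1%g f) = f;
  ghomM : forall s t y x (f : mor y x),
    hcast (gobM s t y) (gobM s t x) (ghom (s * t)%g f) = ghom s (ghom t f);
  ghom_id : forall s x, ghom s (mid x) = mid (gob s x);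
  ghom_comp : forall s z y x (g : mor z y) (f : mor y x),
    ghom s (mcomp g f) = mcomp (ghom s g) (ghom s f)
}.

HB.instance Definition _ (k : fieldType) (G : groupType) (C : gkcat k G)
    (s : G) (y x : C) :=
  GRing.isLinear.Build k (mor y x) (mor (gob s y) (gob s x)) *:%R
    (@ghom k G C s y x) (@ghom_linear k G C s y x).

Definition free_action (k : fieldType) (G : groupType) (C : gkcat k G) : Prop :=
  forall (s : G) (x : C), gob s x = x -> s = 1%g.

Section Translate.
Variables (k : fieldType) (G : groupType) (C : gkcat k G).
Implicit Types (s t : G) (x y z : C).

(* [sf], viewed as a morphism between objects equal to [sx] and [sy] *)
Definition translate s y x y' x' (ey : gob s y = y') (ex : gob s x = x')
  (f : mor y x) : mor y' x' := hcast ey ex (ghom s f).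

Fact translate_linear s y x y' x' (ey : gob s y = y') (ex : gob s x = x') :
  linear (translate ey ex).
Proof. by case: _ / ey; case: _ / ex => a u v; apply: ghom_linear. Qed.

HB.instance Definition _ s y x y' x' (ey : gob s y = y') (ex : gob s x = x') :=
  GRing.isLinear.Build k (mor y x) (mor y' x') *:%R (translate ey ex)
    (translate_linear ey ex).

Lemma translate_erefl s y x (f : mor y x) :
  translate (erefl (gob s y)) (erefl (gob s x)) f = ghom s f.
Proof. by []. Qed.

Lemma translate_irr s y x y' x' (ey ey' : gob s y = y') (ex ex' : gob s x = x') :
  translate ey ex =1 translate ey' ex'.
Proof. by rewrite (eq_irrelevance ey ey') (eq_irrelevance ex ex'). Qed.

Lemma translate1 y x (ey : gob 1 y = y) (ex : gob 1 x = x) (f : mor y x) :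
  translate ey ex f = f.
Proof. by rewrite (translate_irr ey (gob1 y) ex (gob1 x)) /translate ghom1. Qed.

Lemma translate_comp s z y x z' y' x' (ez : gob s z = z') (ey : gob s y = y')
    (ex : gob s x = x') (g : mor z y) (f : mor y x) :
  translate ez ex (mcomp g f) = mcomp (translate ez ey g) (translate ey ex f).
Proof. by case: _ / ez; case: _ / ey; case: _ / ex; apply: ghom_comp. Qed.

Lemma translate_id s x x' (ex : gob s x = x') : translate ex ex (mid x) = mid x'.
Proof. by case: _ / ex; apply: ghom_id. Qed.

Lemma translateM s t y x y' x' y'' x'' (ey : gob t y = y') (ex : gob t x = x')
    (ey' : gob s y' = y'') (ex' : gob s x' = x'')
    (ey'' : gob (s * t) y = y'') (ex'' : gob (s * t) x = x'') (f : mor y x) :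
  translate ey' ex' (translate ey ex f) = translate ey'' ex'' f.
Proof.
move: ey'' ex''; case: _ / ey'; case: _ / ex'; case: _ / ey; case: _ / ex => ey ex.
by rewrite !translate_erefl -ghomM (translate_irr ey (gobM s t y) ex (gobM s t x)).
Qed.

Lemma translate_eq s t y x y' x' (ey : gob s y = y') (ex : gob s x = x')
    (ey' : gob t y = y') (ex' : gob t x = x') (f : mor y x) :
  s = t -> translate ey ex f = translate ey' ex' f.
Proof. by move=> st; case: _ / st ey' ex' => ey' ex'; apply: translate_irr. Qed.

Lemma gobK s : cancel (@gob k G C s) (@gob k G C s^-1).
Proof. by move=> x; rewrite -gobM mulVg gob1. Qed.

Lemma gobVK s : cancel (@gob k G C s^-1) (@gob k G C s).
Proof. by move=> x; rewrite -gobM mulgV gob1. Qed.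

End Translate.

(** * The quot_space category *)

Section Orbits.
Variables (k : fieldType) (G : groupType) (C : gkcat k G).

Definition orbit_rel : rel C := fun x y => `[< exists s : G, gob s x = y >].

Fact orbit_rel_equiv : equiv_class_of orbit_rel.
Proof.
split=> [x|x y|y x z].
- by apply/asboolP; exists 1%g; apply: gob1.
- by apply/asboolP/asboolP=> -[s <-]; exists (s^-1)%g; rewrite gobK.
- move=> /asboolP[s <-] /asboolP[t <-]; apply/asboolP.
  by exists (t * s)%g; rewrite gobM.
Qed.

Canonical orbit_equiv := EquivRelPack orbit_rel_equiv.
Canonical orbit_encModRel := defaultEncModRel orbit_rel.

Definition orbits : choiceType := {eq_quot orbit_rel}.

Definition orb (x : C) : orbits := \pi_({eq_quot orbit_rel}) x.

Lemma orbP (x y : C) : reflect (exists s : G, gob s x = y) (orb x == orb y).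
Proof. by rewrite /orb eqmodE; apply: asboolP. Qed.

Lemma orb_gob (s : G) (x : C) : orb (gob s x) = orb x.
Proof. by apply/esym/eqP/orbP; exists s. Qed.

Definition orbit_pt (a : orbits) : choiceType := {x : C | orb x == a}.

Definition pt (x : C) : orbit_pt (orb x) := exist _ x (eqxx (orb x)).

Fact orbit_repr_subproof (a : orbits) : orb (repr a) == a.
Proof. by rewrite /orb reprK. Qed.
Definition orbit_repr (a : orbits) : orbit_pt a :=
  exist _ (repr a) (orbit_repr_subproof a).

Fact pt_act_subproof (a : orbits) (s : G) (x : orbit_pt a) :
  orb (gob s (val x)) == a.
Proof. by rewrite orb_gob; exact: (valP x). Qed.
Definition pt_act (a : orbits) (s : G) (x : orbit_pt a) : orbit_pt a :=
  exist _ (gob s (val x)) (pt_act_subproof s x).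

Lemma pt_actE a s (x : orbit_pt a) : val (pt_act s x) = gob s (val x).
Proof. by []. Qed.

Lemma pt_actVK a s (x : orbit_pt a) : pt_act s (pt_act s^-1 x) = x.
Proof. by apply: val_inj; rewrite !pt_actE gobVK. Qed.

Fact transporter (a : orbits) (x y : orbit_pt a) :
  exists s : G, gob s (val x) = val y.
Proof. by apply/orbP; rewrite (eqP (valP x)) (eqP (valP y)). Qed.

End Orbits.

Section QuotientHom.
Variables (k : fieldType) (G : groupType) (C : gkcat k G).
Variables (b a : orbits C).

Definition pair_index : choiceType := (orbit_pt b * orbit_pt a)%type.

Definition pair_act (s : G) (p : pair_index) : pair_index :=
  (pt_act s p.1, pt_act s p.2).

Lemma pair_actVK s p : pair_act s (pair_act s^-1 p) = p.
Proof. by case: p => y x; rewrite /pair_act /= !pt_actVK. Qed.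

Definition mor_at (p : pair_index) : lmodType k := mor (val p.1) (val p.2).

(* the direct sum of the yCx for x in a and y in b *)
Definition mor_sum : lmodType k := dsum mor_at.

Definition mor_sum_act_fun (s : G) (m : mor_sum) : dep_prod mor_at :=
  fun p => translate (gobVK s (val p.1)) (gobVK s (val p.2))
             (val m (pair_act s^-1 p)).

Fact mor_sum_act_subproof s m : mor_sum_act_fun s m \in finsupp_pred mor_at.
Proof.
have [l _ hl] := dsum_supp m; apply/asboolP; exists [seq pair_act s p | p <- l].
move=> p pl; rewrite /mor_sum_act_fun hl ?linear0 //.
by apply: contra pl => pl; rewrite -[p](pair_actVK s) map_f.
Qed.

Definition mor_sum_act s (m : mor_sum) : mor_sum :=
  Sub (mor_sum_act_fun s m) (mor_sum_act_subproof s m).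

Lemma mor_sum_actE s (m : mor_sum) (p q : pair_index)
    (ey : gob s (val q.1) = val p.1) (ex : gob s (val q.2) = val p.2) :
  val (mor_sum_act s m) p = translate ey ex (val m q).
Proof.
have qE : q = pair_act s^-1 p.
  case: q p ey ex => y x [y' x'] /= ey ex.
  by congr (_, _); apply: val_inj; rewrite /= -?ey -?ex gobK.
by case: _ / (esym qE) ey ex => ey ex; apply: translate_irr.
Qed.

Fact mor_sum_act_linear s : linear (mor_sum_act s).
Proof.
move=> a' u v; apply: dsumP => p.
pose ey := gobVK s (val p.1); pose ex := gobVK s (val p.2).
exact: (@translate_linear _ _ _ _ _ _ _ _ ey ex).
Qed.

Fact mor_sum_act1 m : mor_sum_act 1%g m = m.
Proof.
apply: dsumP => p.
by rewrite (mor_sum_actE _ (gob1 _) (gob1 _)) translate1.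
Qed.

Fact mor_sum_actM s t m : mor_sum_act (s * t)%g m = mor_sum_act s (mor_sum_act t m).
Proof.
apply: dsumP => p; set q := pair_act s^-1 p; set r := pair_act t^-1 q.
have ey : gob s (val q.1) = val p.1 by apply: gobVK.
have ex : gob s (val q.2) = val p.2 by apply: gobVK.
have ey' : gob t (val r.1) = val q.1 by apply: gobVK.
have ex' : gob t (val r.2) = val q.2 by apply: gobVK.
have ey'' : gob (s * t) (val r.1) = val p.1 by rewrite gobM ey'.
have ex'' : gob (s * t) (val r.2) = val p.2 by rewrite gobM ex'.
rewrite (mor_sum_actE _ ey'' ex'') (mor_sum_actE _ ey ex).
by rewrite (mor_sum_actE _ ey' ex') (translateM _ _ _ _ ey'' ex'').
Qed.

Definition mor_sum_gmodule : gmodule k G :=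
  GModule mor_sum_act_linear mor_sum_act1 mor_sum_actM.

(* the morphisms from a to b in C/G *)
Definition qmor : lmodType k := coinvariants mor_sum_gmodule.

Definition mor_class (p : pair_index) (f : mor (val p.1) (val p.2)) : qmor :=
  cls (dsum_inj (M := mor_at) (i := p) f : mor_sum_gmodule).

Fact mor_class_linear p : linear (@mor_class p).
Proof.
move=> c f g; rewrite /mor_class.
by rewrite (dsum_inj_linear (M := mor_at) (i := p) c f g) cls_linear.
Qed.
HB.instance Definition _ p :=
  GRing.isLinear.Build k (mor_at p) qmor *:%R (@mor_class p) (@mor_class_linear p).

Lemma mor_class_translate s (p q : pair_index)
    (ey : gob s (val p.1) = val q.1) (ex : gob s (val p.2) = val q.2)
    (f : mor (val p.1) (val p.2)) :
  @mor_class q (translate ey ex f) = mor_class f.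
Proof.
apply/cls_eq/asboolP; pose v : mor_sum_gmodule := dsum_inj (M := mor_at) (i := p) f.
exists [:: (1, gmod_act s v - v)].
  by move=> c; rewrite inE => /eqP ->; exists s; eexists.
rewrite big_seq1 scale1r; congr (_ - _); apply: dsumP => r /=.
rewrite -/(mor_sum_act_fun s _ r).
pose w := pair_act s^-1 r.
have wy : gob s (val w.1) = val r.1 by apply: gobVK.
have wx : gob s (val w.2) = val r.2 by apply: gobVK.
rewrite [RHS](mor_sum_actE _ wy wx).
move: w wy wx => w wy wx.
have eq_pt o (x x' : orbit_pt o) : gob s (val x) = gob s (val x') -> x = x'.
  by move=> e; apply/val_inj/(can_inj (gobK s)).
have [pw|pw] := eqVneq p w.
  case: _ / pw wy wx => wy wx; rewrite [X in translate wy wx X]dsum_inj_funE.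
  have qr : q = r.
    by rewrite [q]surjective_pairing [r]surjective_pairing;
      congr (_, _); apply: val_inj; rewrite -?ey -?ex ?wy ?wx.
  by case: _ / qr wy wx => wy wx; rewrite dsum_inj_funE; apply: translate_irr.
rewrite [X in translate wy wx X](dsum_inj_fun0 _ pw) linear0 dsum_inj_fun0 //.
apply: contra_neq pw => qr; rewrite [p]surjective_pairing [w]surjective_pairing.
by congr (_, _); apply: eq_pt; rewrite ?ey ?ex ?wy ?wx qr.
Qed.

(* Linear maps out of the coinvariants of the direct sum, given by a family of
   linear maps compatible with the action. *)
Definition qmor_ext (V : lmodType k)
    (F : forall p : pair_index, mor (val p.1) (val p.2) -> V) (u : qmor) : V :=
  dsum_ext (M := mor_at) F (repr u).

Lemma qmor_ind (P : qmor -> Prop) :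
  P 0 -> (forall u v, P u -> P v -> P (u + v)) ->
  (forall (p : pair_index) (f : mor (val p.1) (val p.2)), P (@mor_class p f)) -> forall u, P u.
Proof.
move=> P0 PD Pc u; rewrite -(clsK u).
have [l ul hl] := dsum_supp (repr u); rewrite (dsum_decomp ul hl).
elim: l {ul hl} => [|p l IH]; first by rewrite big_nil linear0.
by rewrite big_cons linearD; apply: PD => //; apply: Pc.
Qed.

Section Ext.
Variables (V : lmodType k) (F : forall p : pair_index, mor (val p.1) (val p.2) -> V).
Hypothesis FL : forall p, linear (@F p).
Hypothesis FG : forall s (p : pair_index) (f : mor (val p.1) (val p.2)),
  @F (pair_act s p) (ghom s f) = F f.

Lemma dsum_ext_act s (m : mor_sum) :
  dsum_ext (M := mor_at) F (mor_sum_act s m) = dsum_ext (M := mor_at) F m.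
Proof.
have [l ul hl] := dsum_supp m; rewrite (dsum_extE FL ul hl).
rewrite (dsum_extE (l := [seq pair_act s p | p <- l]) FL); first last.
- move=> p pl; rewrite /= /mor_sum_act_fun hl ?linear0 //.
  by apply: contra pl => pl; rewrite -[p](pair_actVK s) map_f.
- rewrite map_inj_uniq // => -[y x] [y' x'] [ey ex].
  by congr (_, _); apply: val_inj; apply: (can_inj (gobK s)).
rewrite big_map; apply: eq_bigr => p _.
by rewrite (@mor_sum_actE s m (pair_act s p) p erefl erefl) translate_erefl FG.
Qed.

Lemma qmor_ext_cls (m : mor_sum) :
  qmor_ext F (cls (m : mor_sum_gmodule)) = dsum_ext (M := mor_at) F m.
Proof.
rewrite /qmor_ext; set r := repr _.
have : r - m \in linspan (fun v : mor_sum_gmodule => exists s m, v = gmod_act s m - m).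
  exact: repr_cls.
have FS := dsum_ext_linear (M := mor_at) FL.
case/asboolP => l hl e; rewrite -[r in LHS](subrK m) -[_ - _]scale1r FS scale1r.
rewrite {}e [X in X + _](_ : _ = 0) ?add0r //.
elim: l hl => [|[c v] l IH] hl.
  by rewrite big_nil; have := FS (-1) 0 0; rewrite !scaleN1r oppr0 addr0 addNr.
rewrite big_cons FS IH ?addr0; last by move=> d dl; apply: hl; rewrite inE dl orbT.
have [/= s [m' ->]] := hl (c, v) (mem_head _ _).
by rewrite addrC -scaleN1r FS scaleN1r dsum_ext_act addNr scaler0.
Qed.

Lemma qmor_ext_class p (f : mor (val p.1) (val p.2)) : qmor_ext F (mor_class f) = F f.
Proof. by rewrite qmor_ext_cls dsum_ext_inj. Qed.

Lemma qmor_ext_linear : linear (qmor_ext F).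
Proof.
move=> c u v; rewrite -(clsK u) -(clsK v) -linearP !qmor_ext_cls.
exact: dsum_ext_linear.
Qed.

End Ext.

End QuotientHom.

Section QuotientComp.
Variables (k : fieldType) (G : groupType) (C : gkcat k G).
Hypothesis Cfree : free_action C.

Lemma free_inj (s t : G) (x : C) : gob s x = gob t x -> s = t.
Proof.
move=> st; have /Cfree e : gob (t^-1 * s)%g x = x by rewrite gobM st gobK.
by apply/(mulgI t^-1%g); rewrite e mulVg.
Qed.

(* [g (sf)], where [s] is the element of [G] with [s y = y'] *)
Definition pair_comp (c b a : orbits C) (p : pair_index c b) (q : pair_index b a)
    (g : mor (val p.1) (val p.2)) (f : mor (val q.1) (val q.2)) : qmor c a :=
  let: exist s sy := cid (transporter q.1 p.2) in
  @mor_class _ _ _ _ _ (p.1, pt_act s q.2) (mcomp g (translate sy erefl f)).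

(* the bilinear extension of [pair_comp]; see [qcomp_class] *)
Definition qcomp (c b a : orbits C) (v : qmor c b) (u : qmor b a) : qmor c a :=
  qmor_ext (fun p g => qmor_ext (fun q f => pair_comp g f) u) v.

Lemma pair_compE c b a (p : pair_index c b) (q : pair_index b a)
    (g : mor (val p.1) (val p.2)) (f : mor (val q.1) (val q.2))
    (s : G) (x : orbit_pt a)
    (sy : gob s (val q.1) = val p.2) (sx : gob s (val q.2) = val x) :
  pair_comp g f = @mor_class _ _ _ _ _ (p.1, x) (mcomp g (translate sy sx f)).
Proof.
rewrite /pair_comp; case: cid => t ty.
have st : s = t by apply: (@free_inj _ _ (val q.1)); rewrite sy ty.
have xE : pt_act s q.2 = x by apply: val_inj.
case: _ / st ty => ty; case: _ / xE sx => sx.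
by rewrite (translate_irr ty sy erefl sx).
Qed.

Fact pair_comp_linear_l c b a (p : pair_index c b) (q : pair_index b a)
    (f : mor (val q.1) (val q.2)) :
  linear (fun g : mor (val p.1) (val p.2) => pair_comp g f).
Proof.
move=> r g g'; rewrite /pair_comp; case: cid => s sy.
by rewrite mcomp_linear_l; apply: mor_class_linear.
Qed.

Fact pair_comp_linear_r c b a (p : pair_index c b) (q : pair_index b a)
    (g : mor (val p.1) (val p.2)) :
  linear (fun f : mor (val q.1) (val q.2) => pair_comp g f).
Proof.
move=> r f f'; rewrite /pair_comp; case: cid => s sy.
by rewrite translate_linear mcomp_linear_r; apply: mor_class_linear.
Qed.

Fact pair_comp_act_r c b a (p : pair_index c b) (t : G) (q : pair_index b a)
    (g : mor (val p.1) (val p.2)) (f : mor (val q.1) (val q.2)) :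
  pair_comp (q := pair_act t q) g (ghom t f) = pair_comp g f.
Proof.
have [s sy] := transporter (pair_act t q).1 p.2.
have sy' : gob (s * t)%g (val q.1) = val p.2 by rewrite gobM.
have sx : gob (s * t)%g (val q.2) = val (pt_act s (pair_act t q).2) by rewrite gobM.
rewrite (pair_compE _ _ sy' sx).
rewrite (@pair_compE _ _ _ p (pair_act t q) _ _ s (pt_act s (pair_act t q).2) sy erefl).
by rewrite -translate_erefl (translateM _ _ _ _ sy' sx).
Qed.

Fact pair_comp_act_l c b a (t : G) (p : pair_index c b) (q : pair_index b a)
    (g : mor (val p.1) (val p.2)) (f : mor (val q.1) (val q.2)) :
  pair_comp (p := pair_act t p) (ghom t g) f = pair_comp g f.
Proof.
have [s sy] := transporter q.1 p.2.
pose x := pt_act s q.2.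
have sx : gob s (val q.2) = val x by [].
have sy' : gob (t * s)%g (val q.1) = val (pair_act t p).2 by rewrite gobM sy.
have sx' : gob (t * s)%g (val q.2) = val (pt_act t x) by rewrite gobM sx.
rewrite (pair_compE _ _ sy sx) (@pair_compE _ _ _ (pair_act t p) q _ _ _ (pt_act t x) sy' sx').
rewrite -[RHS](@mor_class_translate _ _ _ _ _ t (p.1, x) ((pair_act t p).1, pt_act t x)
  erefl erefl).
rewrite translate_erefl ghom_comp -[ghom t (translate _ _ _)]translate_erefl.
by rewrite (translateM _ _ _ _ sy' sx').
Qed.

Definition half_comp c b a (p : pair_index c b) (g : mor (val p.1) (val p.2))
    (u : qmor b a) : qmor c a :=
  qmor_ext (fun (q : pair_index b a) f => pair_comp g f) u.

Lemma half_comp_class c b a (p : pair_index c b) (q : pair_index b a)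
    (g : mor (val p.1) (val p.2)) (f : mor (val q.1) (val q.2)) :
  half_comp g (mor_class f) = pair_comp g f.
Proof.
apply: qmor_ext_class => [q'|s q' f']; first exact: pair_comp_linear_r.
exact: pair_comp_act_r.
Qed.

Fact half_comp_linear_r c b a (p : pair_index c b) (g : mor (val p.1) (val p.2)) :
  linear (@half_comp c b a p g).
Proof.
apply: qmor_ext_linear => [q'|s q' f']; first exact: pair_comp_linear_r.
exact: pair_comp_act_r.
Qed.
HB.instance Definition _ c b a (p : pair_index c b) (g : mor (val p.1) (val p.2)) :=
  GRing.isLinear.Build k (qmor b a) (qmor c a) *:%R (@half_comp c b a p g)
    (@half_comp_linear_r c b a p g).

Let half_comp0 c b a (p : pair_index c b) (g : mor (val p.1) (val p.2)) :
  half_comp g (0 : qmor b a) = 0.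
Proof. exact: linear0. Qed.

Let half_compD c b a (p : pair_index c b) (g : mor (val p.1) (val p.2)) (u w : qmor b a) :
  half_comp g (u + w) = half_comp g u + half_comp g w.
Proof. exact: linearD. Qed.

Fact half_comp_linear_l c b a (p : pair_index c b) (u : qmor b a) :
  linear (fun g : mor (val p.1) (val p.2) => half_comp g u).
Proof.
move=> r g g'; elim/qmor_ind: u => [|u u' Hu Hu'|q f].
- by rewrite !half_comp0 scaler0 addr0.
- by rewrite !half_compD Hu Hu' scalerDr addrACA.
- by rewrite !half_comp_class pair_comp_linear_l.
Qed.

Fact half_comp_act_l c b a (t : G) (p : pair_index c b) (u : qmor b a)
    (g : mor (val p.1) (val p.2)) :
  half_comp (p := pair_act t p) (ghom t g) u = half_comp g u.
Proof.
elim/qmor_ind: u => [|u u' Hu Hu'|q f].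
- by rewrite !half_comp0.
- by rewrite !half_compD Hu Hu'.
- by rewrite !half_comp_class pair_comp_act_l.
Qed.

Lemma qcomp_half c b a (p : pair_index c b) (g : mor (val p.1) (val p.2)) (u : qmor b a) :
  qcomp (mor_class g) u = half_comp g u.
Proof.
apply: (qmor_ext_class (F := fun p g => half_comp g u)) => [p'|s p' g'].
  exact: half_comp_linear_l.
exact: half_comp_act_l.
Qed.

Fact qcomp_linear_l c b a (u : qmor b a) : linear (fun v : qmor c b => qcomp v u).
Proof.
apply: (qmor_ext_linear (F := fun p g => half_comp g u)) => [p'|s p' g'].
  exact: half_comp_linear_l.
exact: half_comp_act_l.
Qed.

Let qcomp0l c b a (u : qmor b a) : qcomp (0 : qmor c b) u = 0.
Proof.
by have := @qcomp_linear_l c b a u (-1) 0 0; rewrite !scaleN1r oppr0 addr0 addNr.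
Qed.

Let qcompDl c b a (u : qmor b a) (v w : qmor c b) :
  qcomp (v + w) u = qcomp v u + qcomp w u.
Proof. by have := @qcomp_linear_l c b a u 1 v w; rewrite !scale1r. Qed.

Fact qcomp_linear_r c b a (v : qmor c b) : linear (fun u : qmor b a => qcomp v u).
Proof.
move=> r u u'; elim/qmor_ind: v => [|v v' Hv Hv'|p g].
- by rewrite !qcomp0l scaler0 addr0.
- by rewrite !qcompDl Hv Hv' scalerDr addrACA.
- by rewrite !qcomp_half; apply: half_comp_linear_r.
Qed.

Let qcomp0r c b a (v : qmor c b) : qcomp v (0 : qmor b a) = 0.
Proof.
by have := @qcomp_linear_r c b a v (-1) 0 0; rewrite !scaleN1r oppr0 addr0 addNr.
Qed.

Let qcompDr c b a (v : qmor c b) (u w : qmor b a) :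
  qcomp v (u + w) = qcomp v u + qcomp v w.
Proof. by have := @qcomp_linear_r c b a v 1 u w; rewrite !scale1r. Qed.

Lemma qcomp_class c b a (p : pair_index c b) (q : pair_index b a)
    (g : mor (val p.1) (val p.2)) (f : mor (val q.1) (val q.2))
    (s : G) (x : orbit_pt a)
    (sy : gob s (val q.1) = val p.2) (sx : gob s (val q.2) = val x) :
  qcomp (mor_class g) (mor_class f) =
  @mor_class _ _ _ _ _ (p.1, x) (mcomp g (translate sy sx f)).
Proof. by rewrite qcomp_half half_comp_class; apply: pair_compE. Qed.

Fact qcompA d c b a (w : qmor d c) (v : qmor c b) (u : qmor b a) :
  qcomp w (qcomp v u) = qcomp (qcomp w v) u.
Proof.
elim/qmor_ind: w => [|w w' Hw Hw'|o h]; first by rewrite !qcomp0l.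
  by rewrite !qcompDl Hw Hw'.
elim/qmor_ind: v => [|v v' Hv Hv'|p g].
- by rewrite qcomp0r !qcomp0l qcomp0r.
- by rewrite qcompDr !qcompDl qcompDr Hv Hv'.
elim/qmor_ind: u => [|u u' Hu Hu'|q f].
- by rewrite !qcomp0r.
- by rewrite !qcompDr Hu Hu'.
have [s sy] := transporter q.1 p.2; have [t tz] := transporter p.1 o.2.
pose x := pt_act s q.2; pose y := pt_act t p.2.
have sx : gob s (val q.2) = val x by [].
have ty : gob t (val p.2) = val y by [].
have tx : gob t (val x) = val (pt_act t x) by [].
have tsy : gob (t * s)%g (val q.1) = val y by rewrite gobM sy.
have tsx : gob (t * s)%g (val q.2) = val (pt_act t x) by rewrite gobM.
rewrite (qcomp_class _ _ sy sx) (qcomp_class _ _ tz ty).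
rewrite (@qcomp_class _ _ _ o (p.1, x) _ _ t (pt_act t x) tz tx).
rewrite (@qcomp_class _ _ _ (o.1, y) q _ _ (t * s)%g (pt_act t x) tsy tsx).
by rewrite (translate_comp tz ty tx) (translateM _ _ _ _ tsy tsx) mcompA.
Qed.

Definition qid (a : orbits C) : qmor a a :=
  @mor_class _ _ _ _ _ (orbit_repr a, orbit_repr a) (mid (val (orbit_repr a))).

Lemma qidE (a : orbits C) (x : orbit_pt a) :
  qid a = @mor_class _ _ _ _ _ (x, x) (mid (val x)).
Proof.
have [s sx] := transporter (orbit_repr a) x.
rewrite /qid -[LHS](@mor_class_translate _ _ _ _ _ s (orbit_repr a, orbit_repr a) (x, x) sx sx).
by rewrite translate_id.
Qed.

Fact qcomp_idl b a (u : qmor b a) : qcomp (qid b) u = u.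
Proof.
elim/qmor_ind: u => [|u u' Hu Hu'|[y x] f]; first by rewrite qcomp0r.
  by rewrite qcompDr Hu Hu'.
rewrite (qidE y) (@qcomp_class _ _ _ (y, y) (y, x) _ _ 1%g x (gob1 _) (gob1 _)).
by rewrite mcomp_idl translate1.
Qed.

Fact qcomp_idr b a (u : qmor b a) : qcomp u (qid a) = u.
Proof.
elim/qmor_ind: u => [|u u' Hu Hu'|[y x] f]; first by rewrite qcomp0l.
  by rewrite qcompDl Hu Hu'.
rewrite (qidE x) (@qcomp_class _ _ _ (y, x) (x, x) _ _ 1%g x (gob1 _) (gob1 _)).
by rewrite translate1 mcomp_idr.
Qed.

Definition quotient_kcat : kcat k :=
  KCat (ob := orbits C) (mor := @qmor k G C) (mcomp := qcomp) (mid := qid)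
    qcomp_linear_l qcomp_linear_r qcompA qcomp_idl qcomp_idr.

(* the Galois covering C -> C/G *)
Definition galois_mor (y x : C) (f : mor y x) :
    mor (orb y : quotient_kcat) (orb x : quotient_kcat) :=
  @mor_class _ _ _ _ _ (pt y, pt x) f.

Fact galois_mor_linear y x : linear (@galois_mor y x).
Proof. exact: (@mor_class_linear _ _ _ _ _ (pt y, pt x)). Qed.
HB.instance Definition _ y x :=
  GRing.isLinear.Build k (mor y x) (mor (orb y : quotient_kcat) (orb x : quotient_kcat))
    *:%R (@galois_mor y x) (@galois_mor_linear y x).

Lemma galois_mor_id x : galois_mor (mid x) = mid (orb x : quotient_kcat).
Proof. by rewrite /= (qidE (pt x)). Qed.

Lemma galois_mor_comp z y x (g : mor z y) (f : mor y x) :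
  galois_mor (mcomp g f) = mcomp (galois_mor g) (galois_mor f).
Proof.
rewrite /= (@qcomp_class _ _ _ (pt z, pt y) (pt y, pt x) g f 1%g (pt x) (gob1 _) (gob1 _)).
by rewrite translate1.
Qed.

(* The projection of the morphisms from [orb x] to [orb y] in C/G, which are the
   direct sum of the y'Cx for y' in the orbit of y, onto yCx. *)
Definition component_at (y x : C) (p : pair_index (orb y) (orb x))
    (f : mor (val p.1) (val p.2)) : mor y x :=
  match pselect (exists s : G, gob s (val p.1) = y /\ gob s (val p.2) = x) with
  | left h => let: exist s (conj sy sx) := cid h in translate sy sx f
  | right _ => 0
  end.

Definition component (y x : C)
    (u : mor (orb y : quotient_kcat) (orb x : quotient_kcat)) : mor y x :=
  qmor_ext (@component_at y x) u.

Lemma component_atE y x (p : pair_index (orb y) (orb x)) (s : G)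
    (sy : gob s (val p.1) = y) (sx : gob s (val p.2) = x)
    (f : mor (val p.1) (val p.2)) :
  component_at f = translate sy sx f.
Proof.
rewrite /component_at; case: pselect => [h|[]]; last by exists s.
case: cid => t [ty tx]; apply: translate_eq.
by apply: (@free_inj _ _ (val p.1)); rewrite sy ty.
Qed.

Lemma component_at0 y x (p : pair_index (orb y) (orb x)) (f : mor (val p.1) (val p.2)) :
  ~ (exists s : G, gob s (val p.1) = y /\ gob s (val p.2) = x) -> component_at f = 0.
Proof. by rewrite /component_at; case: pselect. Qed.

Fact component_at_linear y x p : linear (@component_at y x p).
Proof.
move=> a f g; rewrite /component_at; case: pselect => [h|_].
  by case: cid => s [sy sx]; rewrite linearP.
by rewrite scaler0 addr0.
Qed.

Fact component_at_act y x (t : G) (p : pair_index (orb y) (orb x))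
    (f : mor (val p.1) (val p.2)) :
  @component_at y x (pair_act t p) (ghom t f) = component_at f.
Proof.
have [[s [sy sx]]|h] := pselect (exists s, gob s (val (pair_act t p).1) = y /\
    gob s (val (pair_act t p).2) = x); last first.
  rewrite !component_at0 // => -[s [sy sx]]; apply: h; exists (s * t^-1)%g.
  by rewrite /= !gobM !gobK.
have sy' : gob (s * t)%g (val p.1) = y by rewrite gobM.
have sx' : gob (s * t)%g (val p.2) = x by rewrite gobM.
rewrite (component_atE sy' sx') (@component_atE _ _ (pair_act t p) s sy sx).
by rewrite -translate_erefl (translateM _ _ _ _ sy' sx').
Qed.

Fact component_linear y x : linear (@component y x).
Proof.
exact: (qmor_ext_linear (@component_at_linear y x) (@component_at_act y x)).
Qed.

Lemma component_class y x (p : pair_index (orb y) (orb x)) (f : mor (val p.1) (val p.2)) :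
  component (mor_class f : mor (orb y : quotient_kcat) (orb x : quotient_kcat))
  = component_at f.
Proof.
exact: (qmor_ext_class (@component_at_linear y x) (@component_at_act y x)).
Qed.

Lemma component_galois_mor y x (f : mor y x) : component (galois_mor f) = f.
Proof.
rewrite component_class (@component_atE _ _ (pt y, pt x) 1%g (gob1 y) (gob1 x)).
exact: translate1.
Qed.

Lemma component_neq y x (y' : orbit_pt (orb y)) (f : mor (val y') x) :
  val y' != y ->
  component (@mor_class _ _ _ _ _ (y', pt x) f :
    mor (orb y : quotient_kcat) (orb x : quotient_kcat)) = 0.
Proof.
move=> yy'; rewrite component_class component_at0 // => -[s [/= sy /Cfree s1]].
by case/eqP: yy'; rewrite -[RHS]sy s1 gob1.
Qed.

End QuotientComp.

(** * Hochschild-Mitchell cohomology *)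

Section Chains.
Variables (k : fieldType) (C : kcat k).

(* The sequences (f_n, ..., f_1) of composable morphisms from [x] to [y], the
   intermediate objects x_n, ..., x_2 being part of the data; the outermost
   component is f_1.  The only 0-chains are the objects: [chain 0 y x] is
   [y = x]. *)
Fixpoint chain (n : nat) (y x : C) : Type :=
  if n is m.+1 then {z : C & (chain m y z * mor z x)%type} else y = x.

Definition snoc n (y z x : C) (p : chain n y z) (f : mor z x) : chain n.+1 y x :=
  existT _ z (p, f).

(* (f_n+1, ..., f_1) |-> f_n+1, (f_n, ..., f_1) *)
Fixpoint split_last n (y x : C) : chain n.+1 y x -> {z : C & (mor y z * chain n z x)%type} :=
  match n with
  | 0 => fun p => let: existT z (e, f) := p in
      existT _ x (ecast z' (mor z' x) (esym e) f, erefl x)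
  | m.+1 => fun p => let: existT z (q, f) := p in
      let: existT w (g, r) := split_last q in
      existT _ w (g, snoc r f)
  end.

(* (f_n+1, ..., f_1) |-> (f_n+1, ..., f_i+2 f_i+1, ..., f_1) *)
Fixpoint contract n (y x : C) : 'I_n -> chain n.+1 y x -> chain n y x :=
  match n with
  | 0 => fun i _ => False_rect _ (notF (ltn_ord i))
  | m.+1 => fun i p => let: existT z (q, f) := p in
      if unlift ord0 i is Some j then snoc (contract j q) f
      else let: existT w (r, g) := q in snoc r (mcomp g f)
  end.

(* Linearity in each of f_n, ..., f_1, i.e. the linear maps on the tensor product. *)
Fixpoint multilinear (V : lmodType k) n (y x : C) : (chain n y x -> V) -> Prop :=
  match n with
  | 0 => fun=> True
  | m.+1 => fun F => forall z : C,
      (forall q : chain m y z, linear (fun f : mor z x => F (snoc q f))) /\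
      (forall f : mor z x, multilinear (fun q : chain m y z => F (snoc q f)))
  end.

(* A family indexed by the endpoints and the chains between them: this is the
   product over all x_n+1, ..., x_1 of the maps from
   mor x_n+1 x_n * ... * mor x_2 x_1 to mor x_n+1 x_1, and for n = 0 the
   product of the mor x x. *)
Definition chain_fun n : lmodType k :=
  dep_prod (fun yx : C * C => dep_prod (fun _ : chain n yx.1 yx.2 => mor yx.1 yx.2)).

Definition cochain_pred n : {pred chain_fun n} := fun phi =>
  `[< forall y x : C, @multilinear (mor y x) n y x (phi (y, x)) >].

Lemma multilinearS (V : lmodType k) n y x (F : chain n.+1 y x -> V) :
  multilinear F <-> forall z : C,
    (forall q : chain n y z, linear (fun f : mor z x => F (snoc q f))) /\
    (forall f : mor z x, multilinear (fun q : chain n y z => F (snoc q f))).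
Proof. by []. Qed.

Lemma eq_multilinear (V : lmodType k) n y x (F F' : chain n y x -> V) :
  F =1 F' -> multilinear F -> multilinear F'.
Proof. by move=> FF'; rewrite (functional_extensionality_dep FF'). Qed.

Lemma multilinear0 (V : lmodType k) n y x : @multilinear V n y x (fun=> 0).
Proof.
elim: n x => [|n IH] x //= z; split=> [q a u v|f]; last exact: IH.
by rewrite scaler0 addr0.
Qed.

Lemma multilinearP (V : lmodType k) n y x (a : k) (F F' : chain n y x -> V) :
  multilinear F -> multilinear F' -> multilinear (fun p => a *: F p + F' p).
Proof.
elim: n x F F' => [|n IH] x F F' //= hF hF' z; split=> [q b u v|f].
  rewrite (hF z).1 (hF' z).1 !scalerDr !scalerA (mulrC a) -!addrA; congr (_ + _).
  by rewrite addrCA.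
by apply: IH; [apply: (hF z).2|apply: (hF' z).2].
Qed.

Lemma multilinear_comp (V W : lmodType k) (h : V -> W) n y x (F : chain n y x -> V) :
  linear h -> multilinear F -> multilinear (fun p => h (F p)).
Proof.
move=> hL; elim: n x F => [|n IH] x F //= hF z; split=> [q b u v|f].
  by rewrite (hF z).1 hL.
exact: (IH _ _ ((hF z).2 f)).
Qed.

Lemma multilinear_sum (V : lmodType k) (I : Type) (l : seq I) n y x
    (F : I -> chain n y x -> V) :
  (forall i, multilinear (F i)) -> multilinear (fun p => \sum_(i <- l) F i p).
Proof.
move=> hF; elim: l => [|i l IH].
  by apply: eq_multilinear (multilinear0 V n y x) => p; rewrite big_nil.
apply: eq_multilinear (multilinearP 1 (hF i) IH) => p.
by rewrite big_cons scale1r.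
Qed.

Lemma multilinear_split_last (V : lmodType k) n y x
    (F : forall z, mor y z -> chain n z x -> V) :
  (forall z q, linear (fun g => F z g q)) -> (forall z g, multilinear (F z g)) ->
  multilinear (fun p => let: existT z (g, q) := split_last p in F z g q).
Proof.
elim: n x F => [|n IH] x F FL FM; apply/multilinearS => z; split=> [q|f].
- by case: _ / q; exact: FL.
- done.
- move: q => /= q; case: (split_last q) => w [g r] /=.
  exact: (FM w g z).1.
- pose F' w (g : mor y w) (q : chain n w z) := F w g (snoc q f).
  have h := IH z F' (fun w q => FL w (snoc q f)) (fun w g => (FM w g z).2 f).
  apply: eq_multilinear h => q.
  by rewrite /F' [split_last (snoc q f)]/=; case: (split_last q) => w [g r].
Qed.

Lemma multilinear_contract (V : lmodType k) n (i : 'I_n) y x (F : chain n y x -> V) :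
  multilinear F -> multilinear (fun p => F (contract i p)).
Proof.
elim: n i x F => [|n IH] i x F; first by case: i.
move=> /= FM z; case: (unlift ord0 i) => [j|].
  split=> [q|f]; first exact: (FM z).1.
  exact: (IH j z _ ((FM z).2 f)).
split=> [[w [r g]] a u v /=|f w].
  by rewrite mcomp_linear_r; apply: (FM w).1.
split=> [r a u v /=|g /=]; last exact: ((FM w).2 (mcomp g f)).
by rewrite mcomp_linear_l; apply: (FM w).1.
Qed.

Fact cochain_submod n : submod_closed (@cochain_pred n).
Proof.
split=> [|a u v /asboolP hu /asboolP hv]; apply/asboolP => y x.
  exact: multilinear0.
by apply: multilinearP.
Qed.
HB.instance Definition _ n :=
  GRing.isSubmodClosed.Build k (chain_fun n) (@cochain_pred n) (@cochain_submod n).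

Definition cochain n : lmodType k := subspace (@cochain_pred n).

Definition ev n (phi : cochain n) (y x : C) (p : chain n y x) : mor y x :=
  val phi (y, x) p.

Lemma cochainP n (phi psi : cochain n) :
  (forall y x (p : chain n y x), ev phi p = ev psi p) -> phi = psi.
Proof. by move=> e; apply/val_inj/dprodP => -[y x]; apply: dprodP => p; apply: e. Qed.

Lemma ev_multilinear n (phi : cochain n) y x : multilinear (@ev n phi y x).
Proof. by have /asboolP h := valP phi; exact: h. Qed.

Lemma evP n (a : k) (phi psi : cochain n) y x (p : chain n y x) :
  ev (a *: phi + psi) p = a *: ev phi p + ev psi p.
Proof. by []. Qed.

Definition cobound_fun n (phi : cochain n) : chain_fun n.+1 := fun yx p =>
  let: existT z (g, q) := split_last p in
  let: existT w (r, f) := p in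
  (-1) ^+ n.+1 *: mcomp g (ev phi q)
  + \sum_(i < n) (-1) ^+ i.+1 *: ev phi (contract i p)
  + mcomp (ev phi r) f.

Fact cobound_subproof n (phi : cochain n) : cobound_fun phi \in @cochain_pred n.+1.
Proof.
apply/asboolP => y x.
pose A (p : chain n.+1 y x) : mor y x :=
  let: existT z (g, q) := split_last p in mcomp g (ev phi q).
pose B (p : chain n.+1 y x) : mor y x :=
  \sum_(i < n) (-1) ^+ i.+1 *: ev phi (contract i p).
pose D (p : chain n.+1 y x) : mor y x :=
  let: existT w (r, f) := p in mcomp (ev phi r) f.
have AM : multilinear A.
  apply: (multilinear_split_last (F := fun z g q => mcomp g (ev phi q))).
    by move=> z q; apply: mcomp_linear_l.
  by move=> z g; apply: multilinear_comp (mcomp_linear_r g) (ev_multilinear phi z x).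
have BM : multilinear B.
  apply: multilinear_sum => i; apply: (multilinear_comp (h := fun v => (-1) ^+ i.+1 *: v)).
    by move=> a u v; rewrite scalerDr !scalerA mulrC.
  exact: (multilinear_contract i (ev_multilinear phi y x)).
have DM : multilinear D.
  move=> /= z; split=> [q|f]; first exact: mcomp_linear_r.
  exact: multilinear_comp (mcomp_linear_l f) (ev_multilinear phi y z).
apply: eq_multilinear (multilinearP ((-1) ^+ n.+1) AM (multilinearP 1 BM DM)) => p.
rewrite /cobound_fun /A /B /D scale1r addrA /=; case: p => w [r f].
by case: split_last => z [g q].
Qed.

Definition cobound n (phi : cochain n) : cochain n.+1 :=
  Sub (cobound_fun phi) (cobound_subproof phi).

Fact cobound_linear n : linear (@cobound n).
Proof.
move=> a u v; apply: cochainP => y x p; rewrite evP.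
rewrite /ev /= /cobound_fun /=; case: (split_last p) => z [g q]; case: p => w [r f].
rewrite !evP mcomp_linear_r mcomp_linear_l.
under eq_bigr do rewrite evP scalerDr scalerA mulrC -scalerA.
rewrite big_split -scaler_sumr /= !scalerDr !scalerA (mulrC _ a).
by rewrite [RHS]addrACA [X in _ = X + _]addrACA.
Qed.
HB.instance Definition _ n :=
  GRing.isLinear.Build k (cochain n) (cochain n.+1) *:%R (@cobound n) (@cobound_linear n).

Definition cocycle_pred n : {pred cochain n} := fun phi => cobound phi == 0.

Fact cocycle_submod n : submod_closed (@cocycle_pred n).
Proof.
split=> [|a u v /eqP hu /eqP hv]; apply/eqP; first exact: linear0.
by rewrite cobound_linear hu hv scaler0 addr0.
Qed.
HB.instance Definition _ n :=
  GRing.isSubmodClosed.Build k (cochain n) (@cocycle_pred n) (@cocycle_submod n).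

Definition cocycle n : lmodType k := subspace (@cocycle_pred n).

(* the coboundaries of degree n; they are 0 in degree 0 *)
Definition cobound_image n : cochain n -> Prop :=
  match n with
  | 0 => fun phi => phi = 0
  | m.+1 => fun phi => exists chi : cochain m, phi = cobound chi
  end.

Definition coboundary_pred n : {pred cocycle n} := fun phi => `[< cobound_image (val phi) >].

Fact coboundary_submod n : submod_closed (@coboundary_pred n).
Proof.
split=> [|a u v /asboolP hu /asboolP hv]; apply/asboolP.
  by case: n => [|n] //=; exists 0; rewrite linear0.
case: n u v hu hv => [|n] /= u v; first by move=> -> ->; rewrite scaler0 addr0.
by move=> [x ->] [y ->]; exists (a *: x + y); rewrite cobound_linear.
Qed.
HB.instance Definition _ n :=
  GRing.isSubmodClosed.Build k (cocycle n) (@coboundary_pred n) (@coboundary_submod n).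

Definition HH n : lmodType k := quot_space (@coboundary_pred n).

Definition HH_class n (phi : cocycle n) : HH n := cls phi.

End Chains.

Section Action.
Variables (k : fieldType) (G : groupType) (C : gkcat k G).

Fixpoint chain_act (s : G) n (y x : C) :
    chain n y x -> chain n (gob s y) (gob s x) :=
  match n with
  | 0 => fun e => congr1 (gob s) e
  | m.+1 => fun p => let: existT z (q, f) := p in snoc (chain_act s q) (ghom s f)
  end.

Definition chain_translate s n (y x y' x' : C) (ey : gob s y = y') (ex : gob s x = x')
    (p : chain n y x) : chain n y' x' :=
  ecast z (chain n z x') ey (ecast z (chain n (gob s y) z) ex (chain_act s p)).

Lemma chain_translate_snoc s n y z x y' z' x' (ey : gob s y = y')
    (ez : gob s z = z') (ex : gob s x = x') (q : chain n y z) (f : mor z x) :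
  chain_translate ey ex (snoc q f) = snoc (chain_translate ey ez q) (translate ez ex f).
Proof. by case: _ / ey; case: _ / ez; case: _ / ex. Qed.

Lemma chain_translate1 n y x (ey : gob 1 y = y) (ex : gob 1 x = x) (p : chain n y x) :
  chain_translate ey ex p = p.
Proof.
elim: n x ex p => [|n IH] x ex p; first exact: eq_irrelevance.
case: p => z [q f].
by rewrite (chain_translate_snoc _ (gob1 z)) IH translate1.
Qed.

Lemma chain_translateM s t n y x y' x' y'' x'' (ey : gob t y = y') (ex : gob t x = x')
    (ey' : gob s y' = y'') (ex' : gob s x' = x'')
    (ey'' : gob (s * t) y = y'') (ex'' : gob (s * t) x = x'') (p : chain n y x) :
  chain_translate ey' ex' (chain_translate ey ex p) = chain_translate ey'' ex'' p.
Proof.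
elim: n x x' x'' ex ex' ex'' p => [|n IH] x x' x'' ex ex' ex'' p.
  exact: eq_irrelevance.
case: p => z [q f].
rewrite (chain_translate_snoc _ (erefl (gob t z))).
rewrite (chain_translate_snoc _ (erefl (gob s (gob t z)))).
rewrite (chain_translate_snoc _ (gobM s t z)) (IH _ _ _ _ _ (gobM s t z)).
by rewrite (translateM _ _ _ _ (gobM s t z) ex'').
Qed.

Lemma chain_translateVK s n y x (p : chain n y x) :
  chain_translate (gobVK s y) (gobVK s x) (chain_act s^-1 p) = p.
Proof.
rewrite -[chain_act _ _]/(chain_translate erefl erefl p).
have e (z : C) : gob (s * s^-1)%g z = z by rewrite gobM gobVK.
rewrite (chain_translateM _ _ _ _ (e y) (e x)).
by move: (e y) (e x); rewrite mulgV => ey ex; apply: chain_translate1.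
Qed.

Lemma chain_translateK s n y x (p : chain n y x) :
  chain_translate (gobK s y) (gobK s x) (chain_act s p) = p.
Proof.
rewrite -[chain_act _ _]/(chain_translate erefl erefl p).
have e (z : C) : gob (s^-1 * s)%g z = z by rewrite gobM gobK.
rewrite (chain_translateM _ _ _ _ (e y) (e x)).
by move: (e y) (e x); rewrite mulVg => ey ex; apply: chain_translate1.
Qed.

Lemma multilinear_chain_act (V : lmodType k) s n (y x : C)
    (F : chain n (gob s y) (gob s x) -> V) :
  multilinear F -> multilinear (fun p : chain n y x => F (chain_act s p)).
Proof.
elim: n x F => [|n IH] x F // /multilinearS FM; apply/multilinearS => z.
split=> [q a u v|f] /=; last exact: (IH z _ ((FM _).2 _)).
by rewrite ghom_linear (FM _).1.
Qed.

(* The component at (sx_n+1, ..., sx_1) is f |-> s[phi(s^-1 f)]; see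
   [cochain_actE]. *)
Definition cochain_act_fun s n (phi : cochain C n) : chain_fun C n := fun yx p =>
  translate (gobVK s yx.1) (gobVK s yx.2) (ev phi (chain_act s^-1 p)).

Fact cochain_act_subproof s n (phi : cochain C n) :
  cochain_act_fun s phi \in @cochain_pred k C n.
Proof.
apply/asboolP => y x; rewrite /cochain_act_fun /=.
apply: (multilinear_comp (translate_linear (gobVK s y) (gobVK s x))).
exact/multilinear_chain_act/ev_multilinear.
Qed.

Definition cochain_act s n (phi : cochain C n) : cochain C n :=
  Sub (cochain_act_fun s phi) (cochain_act_subproof s phi).

Let ghom_ev_cast s n (phi : cochain C n) y0 x0 y x (ey0 : y0 = y) (ex0 : x0 = x)
    (ey : gob s y0 = gob s y) (ex : gob s x0 = gob s x) (c : chain n y0 x0) :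
  translate ey ex (ev phi c) =
  ghom s (ev phi (ecast z (chain n z x) ey0 (ecast z (chain n y0 z) ex0 c))).
Proof.
move: ey ex; case: _ / ey0; case: _ / ex0 => ey ex.
exact: (translate_irr ey erefl ex erefl).
Qed.

Lemma cochain_act_translate s n (phi : cochain C n) y x y' x'
    (ey : gob s y = y') (ex : gob s x = x') (p : chain n y x) :
  ev (cochain_act s phi) (chain_translate ey ex p) = translate ey ex (ev phi p).
Proof.
case: _ / ey; case: _ / ex; rewrite translate_erefl.
rewrite -[in RHS](chain_translateK s p).
exact: ghom_ev_cast.
Qed.

Lemma cochain_actE s n (phi : cochain C n) y x (p : chain n y x) :
  ev (cochain_act s phi) (chain_act s p) = ghom s (ev phi p).
Proof. exact: (cochain_act_translate phi erefl erefl). Qed.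

Lemma cochain_act_ext s n (phi psi : cochain C n) :
  (forall y x (p : chain n y x), ev phi (chain_act s p) = ev psi (chain_act s p)) ->
  phi = psi.
Proof.
move=> e; apply: cochainP => y x p; rewrite -(chain_translateVK s p).
have {}e y0 x0 y' x' (ey : gob s y0 = y') (ex : gob s x0 = x') c :
    ev phi (chain_translate ey ex c) = ev psi (chain_translate (n := n) ey ex c).
  by case: _ / ey; case: _ / ex; apply: e.
exact: e.
Qed.

Fact cochain_act_linear s n : linear (@cochain_act s n).
Proof.
move=> a u v; apply: (cochain_act_ext (s := s)) => y x p.
by rewrite evP !cochain_actE evP ghom_linear.
Qed.

Fact cochain_act1 n (phi : cochain C n) : cochain_act 1%g phi = phi.
Proof.
apply: cochainP => y x p; rewrite -(chain_translate1 (gob1 y) (gob1 x) p).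
by rewrite cochain_act_translate chain_translate1 translate1.
Qed.

Fact cochain_actM s t n (phi : cochain C n) :
  cochain_act (s * t)%g phi = cochain_act s (cochain_act t phi).
Proof.
apply: (cochain_act_ext (s := (s * t)%g)) => y x p; rewrite cochain_actE.
have M (z : C) := esym (gobM s t z).
rewrite -[chain_act _ p](chain_translateM erefl erefl (M y) (M x) erefl erefl).
by rewrite !cochain_act_translate (translateM _ _ _ _ erefl erefl).
Qed.

Definition cochain_gmodule n : gmodule k G :=
  GModule (fun s => @cochain_act_linear s n) (@cochain_act1 n)
    (fun s t phi => @cochain_actM s t n phi).

Lemma split_last_act s n y x (p : chain n.+1 y x) :
  split_last (chain_act s p) =
  let: existT z (g, q) := split_last p in existT _ (gob s z) (ghom s g, chain_act s q).
Proof.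
elim: n x p => [|n IH] x [z [q f]]; first by case: _ / q f.
by move: (IH z q) => /= ->; case: (split_last q) => w [g r].
Qed.

Lemma contract_act s n (i : 'I_n) y x (p : chain n.+1 y x) :
  contract i (chain_act s p) = chain_act s (contract i p).
Proof.
elim: n i x p => [|n IH] i x; first by case: i.
case=> z [q f]; move: (IH) => /(_ _ z q) {}IH /=.
case: (unlift ord0 i) => [j|]; first by rewrite IH.
by case: q {IH} => w [r g] /=; rewrite ghom_comp.
Qed.

Lemma cobound_act s n (phi : cochain C n) :
  cobound (cochain_act s phi) = cochain_act s (cobound phi).
Proof.
apply: (cochain_act_ext (s := s)) => y x p; rewrite cochain_actE.
rewrite /ev /= /cobound_fun split_last_act.
have cE (i : 'I_n) : 
    ev (cochain_act s phi) (contract i (chain_act s p)) = ghom s (ev phi (contract i p)).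
  by rewrite contract_act cochain_actE.
case: (split_last p) => z [g q]; case: p cE => w [r f] cE.
rewrite !linearD linear_sum linearZ /= !ghom_comp !cochain_actE.
by congr (_ + _ + _); apply: eq_bigr => i _; rewrite linearZ cE.
Qed.

Fact cocycle_act_subproof (s : G) n (phi : cocycle C n) :
  cochain_act s (val phi) \in @cocycle_pred k C n.
Proof.
apply/eqP; rewrite cobound_act (eqP (valP phi)).
exact: (linear0 (gmod_act (g := cochain_gmodule n.+1) s)).
Qed.

Definition cocycle_act (s : G) n (phi : cocycle C n) : cocycle C n :=
  Sub (cochain_act s (val phi)) (cocycle_act_subproof s phi).

Fact cocycle_act_linear s n : linear (@cocycle_act s n).
Proof.
move=> a u v; apply: val_inj.
have e (w : cocycle C n) : val (cocycle_act s w) = cochain_act s (val w) by [].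
rewrite e [RHS](subspace_valP a (cocycle_act s u) (cocycle_act s v)) !e.
by rewrite [val _ in LHS](subspace_valP a u v); apply: cochain_act_linear.
Qed.

Fact cocycle_act1 n (phi : cocycle C n) : cocycle_act 1%g phi = phi.
Proof. by apply: val_inj; apply: cochain_act1. Qed.

Fact cocycle_actM s t n (phi : cocycle C n) :
  cocycle_act (s * t)%g phi = cocycle_act s (cocycle_act t phi).
Proof. by apply: val_inj; apply: cochain_actM. Qed.

Definition cocycle_gmodule n : gmodule k G :=
  GModule (fun s => @cocycle_act_linear s n) (@cocycle_act1 n)
    (fun s t phi => @cocycle_actM s t n phi).

Definition HH_act (s : G) n (h : HH C n) : HH C n := HH_class (cocycle_act s (repr h)).

Lemma HH_actE s n (phi : cocycle C n) :
  HH_act s (HH_class phi) = HH_class (cocycle_act s phi).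
Proof.
apply/cls_eq.
have -> : cocycle_act s (repr (HH_class phi)) - cocycle_act s phi
    = cocycle_act s (repr (HH_class phi) - phi).
  by rewrite -[- cocycle_act s phi]scaleN1r addrC -cocycle_act_linear scaleN1r addrC.
have : repr (HH_class phi) - phi \in @coboundary_pred k C n by apply: repr_cls.
move: (_ - _) => psi /asboolP h; apply/asboolP; rewrite /=.
case: n phi psi h => [|n] _ psi /=.
  by move=> ->; apply: (linear0 (gmod_act (g := cochain_gmodule 0) s)).
by move=> [chi ->]; exists (cochain_act s chi); rewrite cobound_act.
Qed.

Fact HH_act_linear s n : linear (@HH_act s n).
Proof.
move=> a u v; rewrite -(clsK u) -(clsK v) -cls_linear.
rewrite -![cls _]/(HH_class _) !HH_actE cocycle_act_linear.
exact: cls_linear.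
Qed.

Fact HH_act1 n (h : HH C n) : HH_act 1%g h = h.
Proof. by rewrite /HH_act cocycle_act1; apply: clsK. Qed.

Fact HH_actM s t n (h : HH C n) : HH_act (s * t)%g h = HH_act s (HH_act t h).
Proof. by rewrite [HH_act t h]/HH_act HH_actE -cocycle_actM. Qed.

Definition HH_gmodule n : gmodule k G :=
  GModule (fun s => @HH_act_linear s n) (@HH_act1 n)
    (fun s t h => @HH_actM s t n h).

End Action.

(** * The canonical morphisms *)

Section Canonical.
Variables (k : fieldType) (G : groupType) (C : gkcat k G) (Cfree : free_action C).
Local Notation CG := (quotient_kcat Cfree).

(* the image of a chain under C -> C/G *)
Fixpoint galois_chain n (y x : C) :
    chain n y x -> chain (C := CG) n (orb y : CG) (orb x : CG) :=
  match n with
  | 0 => fun e => congr1 (@orb k G C : C -> CG) e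
  | m.+1 => fun p => let: existT z (q, f) := p in
      snoc (galois_chain q) (galois_mor Cfree f)
  end.

(* Every invariant class is the class of an invariant cocycle phi, and iota sends
   it to the class of the cocycle psi of C/G such that
   psi([f_n], ..., [f_1]) = [phi(f_n, ..., f_1)] for f_n, ..., f_1 composable in
   C; every chain of classes of morphisms of C lifts to C, so phi determines
   psi. *)
Definition canonical_inclusion
    (iota : forall n, invariants (HH_gmodule C n) -> HH CG n) : Prop :=
  forall n,
    (forall h : invariants (HH_gmodule C n),
       exists phi : invariants (cocycle_gmodule C n), val h = HH_class (val phi)) /\
    (forall (h : invariants (HH_gmodule C n))
            (phi : invariants (cocycle_gmodule C n)), val h = HH_class (val phi) ->
       exists2 psi : cocycle CG n,
         (forall y x (p : chain n y x),
            ev (val psi) (galois_chain p) = galois_mor Cfree (ev (val (val phi)) p)) &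
         iota n h = HH_class psi).

(* rho sends the class of a cocycle psi of C/G to the class of the invariant
   cocycle of C mapping (f_n, ..., f_1) to the component of
   psi([f_n], ..., [f_1]) between the endpoints of the chain. *)
Definition canonical_retraction
    (rho : forall n, HH CG n -> invariants (HH_gmodule C n)) : Prop :=
  forall n (psi : cocycle CG n),
    exists2 phi : invariants (cocycle_gmodule C n),
      (forall y x (p : chain n y x),
         ev (val (val phi)) p = component (ev (val psi) (galois_chain p))) &
      val (rho n (HH_class psi)) = HH_class (val phi).

End Canonical.

(* Main.v *)
Require Import Defs.
From HB Require Import structures.
From mathcomp Require Import all_boot all_algebra.
From mathcomp Require Import boolp.

Set Implicit Arguments.
Unset Strict Implicit.
Unset Printing Implicit Defensive.

Import GRing.Theory.
Local Open Scope ring_scope.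

(** The idea is that the G-invariant cochains of C form a direct summand of the
Hochschild-Mitchell complex of C/G, and that exactness of the invariants functor
identifies the cohomology of the invariant cochains with the invariants of the
cohomology.

A chain (f_n, ..., f_1) of C has an image in C/G, the chain ([f_n], ..., [f_1]).
Because the action is free, once a point x is chosen above the source of a chain
of C/G, the chain is a sum of images of chains of C starting at x, in a unique way
([chain_ext] extends multilinear maps along this decomposition).  Hence a cochain
of C/G is determined by its values on image chains ([cochain_galois_ext]), and an
invariant cochain phi of C extends to the cochain [descend phi] of C/G whose value
at ([f_n], ..., [f_1]) is [phi(f_n, ..., f_1)] ([descendE]); invariance is what
makes the value independent of x.  Conversely a cochain psi of C/G gives the
cochain [restrict psi] of C whose value at (f_n, ..., f_1) is the component of
psi([f_n], ..., [f_1]) between the endpoints of the chain.  It is invariant, since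
translating the chain does not change its image ([restrict_inv]).

Both maps commute with the coboundary: the first because C -> C/G is a functor,
the second because taking components is a morphism of bimodules over C
([component_comp_l], [component_comp_r]).  Moreover [restrict (descend phi) = phi]
([restrict_descend]), so the invariant cochains are a direct summand.

Exactness enters through [invariant_lift]: an invariant element of the image of an
equivariant map is the image of an invariant element.  For the projection from
cocycles to cohomology this says that invariant classes contain invariant cocycles
([invariant_class]); for the coboundary, that an invariant coboundary bounds an
invariant cochain ([invariant_coboundary]).  The first fact lets [descend] act on
invariant classes, the second makes the result independent of the cocycle. *)

(** * Unbundled linear maps *)

Section LinearFun.
Variables (k : fieldType) (U V : lmodType k) (L : U -> V).
Hypothesis LL : linear L.

Lemma linear_fun0 : L 0 = 0.
Proof. by have := LL (-1) 0 0; rewrite !scaleN1r oppr0 addr0 addNr. Qed.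

Lemma linear_funD u v : L (u + v) = L u + L v.
Proof. by have := LL 1 u v; rewrite !scale1r. Qed.

Lemma linear_funZ a u : L (a *: u) = a *: L u.
Proof. by have := LL a u 0; rewrite linear_fun0 !addr0. Qed.

Lemma linear_funB u v : L (u - v) = L u - L v.
Proof. by rewrite linear_funD -scaleN1r linear_funZ scaleN1r. Qed.

Lemma linear_fun_sum (I : Type) (r : seq I) (F : I -> U) :
  L (\sum_(i <- r) F i) = \sum_(i <- r) L (F i).
Proof. by apply: big_morph; [apply: linear_funD|apply: linear_fun0]. Qed.

End LinearFun.

(** * Lifting invariants along equivariant maps *)

Section SubGmodule.
Variables (k : fieldType) (G : groupType) (M : gmodule k G) (S : submodClosed M).
Hypothesis stable : forall s (m : M), m \in S -> gmod_act s m \in S.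

Definition sub_act s (m : subspace S) : subspace S :=
  Sub (gmod_act s (val m)) (stable s (valP m)).

Fact sub_act_linear s : linear (sub_act s).
Proof.
by move=> a u v; apply: val_inj; rewrite subspace_valP /= gmod_act_linear.
Qed.

Fact sub_act1 m : sub_act 1%g m = m.
Proof. by apply: val_inj; apply: gmod_act1. Qed.

Fact sub_actM s t m : sub_act (s * t)%g m = sub_act s (sub_act t m).
Proof. by apply: val_inj; apply: gmod_actM. Qed.

Definition sub_gmodule : gmodule k G := GModule sub_act_linear sub_act1 sub_actM.

End SubGmodule.

Section InvariantLift.
Variables (k : fieldType) (G : groupType) (N P : gmodule k G).
Variables (g : {linear N -> P}) (gG : equivariant g).

Definition ker_pred : {pred N} := fun m => g m == 0.

Fact ker_submod : submod_closed ker_pred.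
Proof.
split=> [|a u v /eqP gu /eqP gv]; apply/eqP; first exact: linear0.
by rewrite linearP gu gv scaler0 addr0.
Qed.
HB.instance Definition _ := GRing.isSubmodClosed.Build k N ker_pred ker_submod.

Definition im_pred : {pred P} := fun p => `[< exists m, g m = p >].

Fact im_submod : submod_closed im_pred.
Proof.
split=> [|a _ _ /asboolP[u <-] /asboolP[v <-]]; apply/asboolP.
  by exists 0; apply: linear0.
by exists (a *: u + v); apply: linearP.
Qed.
HB.instance Definition _ := GRing.isSubmodClosed.Build k P im_pred im_submod.

Fact ker_stable s m : m \in ker_pred -> gmod_act s m \in ker_pred.
Proof. by move=> /eqP m0; apply/eqP; rewrite gG m0 linear0. Qed.

Fact im_stable s p : p \in im_pred -> gmod_act s p \in im_pred.
Proof. by move=> /asboolP[m <-]; apply/asboolP; exists (gmod_act s m). Qed.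

Definition ker_gmodule := sub_gmodule ker_stable.
Definition im_gmodule := sub_gmodule im_stable.

Definition ker_incl (m : ker_gmodule) : N := val m.

Fact ker_incl_linear : linear ker_incl.
Proof. by []. Qed.
HB.instance Definition _ :=
  GRing.isLinear.Build k ker_gmodule N *:%R ker_incl ker_incl_linear.

Definition im_corestr (m : N) : im_gmodule :=
  Sub (g m) (asboolT (ex_intro (fun m' => g m' = g m) m erefl)).

Fact im_corestr_linear : linear im_corestr.
Proof. by move=> a u v; apply: val_inj; rewrite subspace_valP /= linearP. Qed.
HB.instance Definition _ :=
  GRing.isLinear.Build k N im_gmodule *:%R im_corestr im_corestr_linear.

(** The short exact sequence from the kernel to the source to the image remains
exact on invariants, and surjectivity there is the claim. *)
Lemma invariant_lift (m : N) : invariants_exact k G ->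
  (forall s, gmod_act s (g m) = g m) ->
  exists2 m' : N, (forall s, gmod_act s m' = m') & g m' = g m.
Proof.
move=> Gex inv_gm.
have iG : equivariant ker_incl by [].
have cG : equivariant im_corestr by move=> s u; apply: val_inj; apply: gG.
have [|_ _ surj] := Gex _ _ _ ker_incl im_corestr iG cG.
  split=> [u v|u|[p pP]]; first exact: val_inj.
  - split=> [/(congr1 val) /= gu|[v <-]]; last by apply: val_inj; apply/eqP/(valP v).
    by exists (Sub u (introT eqP gu)).
  - by case/asboolP: (pP) => u gu; exists u; apply: val_inj.
have im_inv : im_corestr m \in @inv_pred k G im_gmodule.
  by apply/asboolP => s; apply: val_inj; apply: inv_gm.
have [[m' /= m'I] /(congr1 (val \o val)) /= gm'] := surj (Sub (im_corestr m) im_inv).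
by exists m' => //; apply/asboolP.
Qed.

End InvariantLift.

(** * Chains and coboundaries *)

Section Chains.
Variables (k : fieldType) (D : kcat k).

(** The images in C/G of a chain and of its translates have the same endpoints
only up to a provable equality of orbits; [chain_cast] states their equality. *)
Definition chain_cast n (y x y' x' : D) (ey : y = y') (ex : x = x')
    (p : chain n y x) : chain n y' x' :=
  ecast z (chain n z x') ey (ecast z (chain n y z) ex p).

Lemma chain_cast_snoc n (y z x y' z' x' : D) (ey : y = y') (ez : z = z') (ex : x = x')
    (q : chain n y z) (f : mor z x) :
  chain_cast ey ex (snoc q f) = snoc (chain_cast ey ez q) (hcast ez ex f).
Proof. by case: _ / ey; case: _ / ez; case: _ / ex. Qed.

Lemma ev_chain_cast n (psi : cochain D n) (y x y' x' : D) (ey : y = y') (ex : x = x')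
    (p : chain n y x) :
  ev psi (chain_cast ey ex p) = hcast ey ex (ev psi p).
Proof. by case: _ / ey; case: _ / ex. Qed.

Lemma split_last_snoc n (y z x : D) (q : chain n.+1 y z) (f : mor z x) :
  split_last (snoc q f) =
  let: existT w (g, r) := split_last q in existT _ w (g, snoc r f).
Proof. by []. Qed.

Lemma contract_snoc0 n (y w z x : D) (r : chain n y w) (g : mor w z) (f : mor z x) :
  contract ord0 (snoc (snoc r g) f) = snoc r (mcomp g f).
Proof. by rewrite [LHS]/contract unlift_none. Qed.

Lemma contract_snocS n (i : 'I_n) (y z x : D) (q : chain n.+1 y z) (f : mor z x) :
  contract (lift ord0 i) (snoc q f) = snoc (contract i q) f.
Proof. by rewrite [LHS]/= liftK. Qed.

Lemma ev_cobound_snoc n (phi : cochain D n) (y z w x : D) (r : chain n y w)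
    (f : mor w x) (g : mor y z) (q : chain n z x) :
  split_last (snoc r f) = existT _ z (g, q) ->
  ev (cobound phi) (snoc r f) =
    (-1) ^+ n.+1 *: mcomp g (ev phi q)
    + \sum_(i < n) (-1) ^+ i.+1 *: ev phi (contract i (snoc r f))
    + mcomp (ev phi r) f.
Proof. by move=> E; rewrite [LHS]/(@cobound_fun k D n phi (y, x) _) /cobound_fun E. Qed.

Lemma hcast_linear (y x y' x' : D) (ey : y = y') (ex : x = x') :
  linear (@hcast k D y x y' x' ey ex).
Proof. by case: _ / ey; case: _ / ex. Qed.

End Chains.

(** * The image of a chain in C/G *)

Section Galois.
Variables (k : fieldType) (G : groupType) (C : gkcat k G) (Cfree : free_action C).
Local Notation CG := (quotient_kcat Cfree).
Local Notation proj := (galois_chain Cfree).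

Lemma pt_ind (P : forall a : orbits C, orbit_pt a -> Prop) :
  (forall x : C, P (orb x) (pt x)) -> forall a (x : orbit_pt a), P a x.
Proof.
move=> Pp a [x xa]; move/eqP: (xa) => e; case: _ / e xa => xa.
by rewrite (eq_irrelevance xa (eqxx _)); apply: Pp.
Qed.

(** A class in C/G does not change under translation, even when the orbits are
only provably equal. *)
Lemma hcast_mor_class (b a b' a' : CG) (eb : b = b') (ea : a = a')
    (p : pair_index b a) (p' : pair_index b' a') s
    (sy : gob s (val p.1) = val p'.1) (sx : gob s (val p.2) = val p'.2)
    (f : mor (val p.1) (val p.2)) :
  hcast eb ea (mor_class f : mor b a) = @mor_class _ _ _ _ _ p' (translate sy sx f).
Proof.
by case: _ / eb p' sy sx; case: _ / ea => p' sy sx; rewrite mor_class_translate.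
Qed.

Lemma translateK s (y x : C) (f : mor y x) :
  translate (gobK s y) (gobK s x) (ghom s f) = f.
Proof.
have e (z : C) : gob (s^-1 * s)%g z = z by rewrite gobM gobK.
rewrite -translate_erefl (translateM _ _ _ _ (e y) (e x)).
by move: (e y) (e x); rewrite mulVg => ey ex; apply: translate1.
Qed.

Lemma hcast_galois_mor_ghom s (y x : C) (f : mor y x) :
  hcast (orb_gob s y : _ = _ :> CG) (orb_gob s x : _ = _ :> CG)
    (galois_mor Cfree (ghom s f)) = galois_mor Cfree f.
Proof.
rewrite (@hcast_mor_class _ _ _ _ _ _ (pt _, pt _) (pt y, pt x) _ (gobK s y) (gobK s x)).
by rewrite translateK.
Qed.

Lemma galois_chain_act s n (y x : C) (p : chain n y x) :
  chain_cast (orb_gob s y : _ = _ :> CG) (orb_gob s x : _ = _ :> CG)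
    (proj (chain_act s p)) = proj p.
Proof.
elim: n x p => [|n IH] x p; first exact: eq_irrelevance.
case: p => z [q f] /=; rewrite (chain_cast_snoc _ (orb_gob s z : _ = _ :> CG)) IH.
by rewrite hcast_galois_mor_ghom.
Qed.

Lemma galois_chain_snoc n (y z x : C) (q : chain n y z) (f : mor z x) :
  proj (snoc q f) = snoc (proj q) (galois_mor Cfree f).
Proof. by []. Qed.

Lemma split_last_galois n (y x : C) (p : chain n.+1 y x) :
  split_last (proj p) =
  let: existT z (g, q) := split_last p in
    existT _ (orb z : CG) (galois_mor Cfree g, proj q).
Proof.
elim: n x p => [|n IH] x [z [q f]]; first by case: _ / q f.
rewrite -[existT _ _ _]/(@snoc k C n.+1 y z x q f) galois_chain_snoc !split_last_snoc IH.
by case: (split_last q) => w [g r].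
Qed.

Lemma contract_galois n (i : 'I_n) (y x : C) (p : chain n.+1 y x) :
  contract i (proj p) = proj (contract i p).
Proof.
elim: n i x p => [|n IH] i x; first by case: i.
case=> z [q f]; rewrite -[existT _ _ _]/(@snoc k C n.+1 y z x q f).
have [j ->|->] := unliftP ord0 i.
  by rewrite galois_chain_snoc !contract_snocS IH -galois_chain_snoc.
case: q => w [r g]; rewrite -[existT _ _ _]/(@snoc k C n y w z r g).
by rewrite !galois_chain_snoc !contract_snoc0 galois_chain_snoc galois_mor_comp.
Qed.

(** By linearity the last entry f of the chain may be taken to be the class of a
morphism of C, and translation moves its source to x; the induction then goes on
from the target of f. *)
Lemma multilinear_galois_ext (V : lmodType k) n (b : CG) (x : C)
    (F F' : chain (C := CG) n b (orb x : CG) -> V) :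
  multilinear F -> multilinear F' ->
  (forall y (e : orb y = b :> CG) (p : chain n y x),
     F (chain_cast e erefl (proj p)) = F' (chain_cast e erefl (proj p))) ->
  F =1 F'.
Proof.
elim: n x F F' => [|n IH] x F F' FM FM' FF' p.
  have -> : p = chain_cast (esym p) erefl (proj (erefl x : chain 0 x x)) by apply: eq_irrelevance.
  exact: FF'.
case: p => c [q f].
elim/qmor_ind: f => [|f f' Hf Hf'|[z x'] f].
- by rewrite (linear_fun0 ((FM c).1 q)) (linear_fun0 ((FM' c).1 q)).
- by rewrite (linear_funD ((FM c).1 q)) (linear_funD ((FM' c).1 q)) Hf Hf'.
have [s sx] := transporter x' (pt x).
rewrite -(@mor_class_translate _ _ _ _ _ s (z, x') (pt_act s z, pt x) erefl sx).
move: (pt_act s z) (translate _ _ _) => {x' sx}z {}f.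
elim/pt_ind: z q f => z q f.
rewrite -[existT _ _ _]/(snoc q (galois_mor Cfree f)).
move: q; apply: IH => [||y e p]; [exact: (FM _).2|exact: (FM' _).2|].
move: (FF' y e (snoc p f)); rewrite [proj _]/(snoc _ _).
by rewrite (chain_cast_snoc _ (erefl _)).
Qed.

Lemma cochain_galois_ext n (psi psi' : cochain CG n) :
  (forall y x (p : chain n y x), ev psi (proj p) = ev psi' (proj p)) -> psi = psi'.
Proof.
move=> H; apply: cochainP => b a; elim/quotW: a => x.
apply: multilinear_galois_ext => [||y e p]; try exact: ev_multilinear.
by rewrite !ev_chain_cast H.
Qed.

(** * Extending multilinear maps from C to C/G *)

Fact lift_end (b a : orbits C) (e : b = a) (x : orbit_pt a) :
  val (ecast c (orbit_pt c) (esym e) x) = val x.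
Proof. by case: _ / e x. Qed.

(** [F] is a family of functions on the chains of C that start at the point [x]
of [a] and end at some point of [b].  A morphism of C/G with source [a] is a sum
of classes of morphisms of C with source [x]; expanding the entries of the chain
one after the other, each from the point where the previous one ended, gives the
extension of [F] to the chains of C/G. *)
Fixpoint chain_ext (V : lmodType k) n (b a : orbits C) (x : orbit_pt a) {struct n} :
    (forall y : orbit_pt b, chain n (val y) (val x) -> V) ->
    chain (C := CG) n (b : CG) (a : CG) -> V :=
  match n with
  | 0 => fun F e => F (ecast c (orbit_pt c) (esym e) x) (lift_end e x)
  | m.+1 => fun F p => let: existT c (q, f) := p in
      qmor_ext (fun (r : pair_index c a) (h : mor (val r.1) (val r.2)) =>
        let: exist s sx := cid (transporter r.2 x) in
        chain_ext (x := pt_act s r.1)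
          (fun y t => F y (snoc t (translate (erefl (gob s (val r.1))) sx h))) q) f
  end.

(** The contribution of a morphism h of C to the expansion: h is translated so
that its source becomes x. *)
Definition chain_ext_step (V : lmodType k) n (b c a : orbits C) (x : orbit_pt a)
    (F : forall y : orbit_pt b, chain n.+1 (val y) (val x) -> V)
    (q : chain (C := CG) n (b : CG) (c : CG)) (r : pair_index c a)
    (h : mor (val r.1) (val r.2)) : V :=
  let: exist s sx := cid (transporter r.2 x) in
  chain_ext (x := pt_act s r.1)
    (fun y t => F y (snoc t (translate (erefl (gob s (val r.1))) sx h))) q.

Lemma chain_ext_snoc (V : lmodType k) n (b c a : orbits C) (x : orbit_pt a)
    (F : forall y : orbit_pt b, chain n.+1 (val y) (val x) -> V)
    (q : chain (C := CG) n (b : CG) (c : CG)) (f : mor (c : CG) (a : CG)) :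
  chain_ext F (snoc q f) = qmor_ext (chain_ext_step F q) f.
Proof. by []. Qed.

(** By freeness, the translation that moves the source of h to x is unique. *)
Lemma chain_ext_stepE (V : lmodType k) n (b c a : orbits C) (x : orbit_pt a)
    (F : forall y : orbit_pt b, chain n.+1 (val y) (val x) -> V)
    (q : chain (C := CG) n (b : CG) (c : CG)) (r : pair_index c a)
    (h : mor (val r.1) (val r.2)) s (z : orbit_pt c)
    (sz : gob s (val r.1) = val z) (sx : gob s (val r.2) = val x) :
  chain_ext_step F q h = chain_ext (x := z) (fun y t => F y (snoc t (translate sz sx h))) q.
Proof.
rewrite /chain_ext_step; case: cid => t tx.
have st : s = t by apply: (free_inj Cfree (x := val r.2)); rewrite sx tx.
have zE : pt_act s r.1 = z by apply: val_inj.
case: _ / st tx => tx; case: _ / zE sz => sz.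
congr (chain_ext _ q); apply: functional_extensionality_dep => y.
apply: functional_extensionality_dep => u.
by rewrite (translate_irr erefl sz tx sx).
Qed.

Lemma chain_ext_step_act (V : lmodType k) n (b c a : orbits C) (x : orbit_pt a)
    (F : forall y : orbit_pt b, chain n.+1 (val y) (val x) -> V)
    (q : chain (C := CG) n (b : CG) (c : CG)) s (r : pair_index c a)
    (h : mor (val r.1) (val r.2)) :
  @chain_ext_step V n b c a x F q (pair_act s r) (ghom s h) = chain_ext_step F q h.
Proof.
have [t tx] := transporter (pair_act s r).2 x.
pose z := pt_act t (pair_act s r).1.
have tsz : gob (t * s)%g (val r.1) = val z by rewrite gobM.
have tsx : gob (t * s)%g (val r.2) = val x by rewrite gobM.
rewrite (chain_ext_stepE _ _ _ tsz tsx).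
rewrite (@chain_ext_stepE _ _ _ _ _ _ _ _ (pair_act s r) _ t z erefl tx).
by rewrite -translate_erefl (translateM _ _ _ _ tsz tsx).
Qed.

(** Linearity in F, named because the induction needs it in the previous degree:
there it yields the linearity of [chain_ext_step] in h, which
[qmor_ext] requires. *)
Definition chain_ext_linear_at (V : lmodType k) n : Prop :=
  forall (b a : orbits C) (x : orbit_pt a) (u : k)
    (F F' : forall y : orbit_pt b, chain n (val y) (val x) -> V),
  (forall y, multilinear (F y)) -> (forall y, multilinear (F' y)) ->
  forall p, chain_ext (fun y t => u *: F y t + F' y t) p
            = u *: chain_ext F p + chain_ext F' p.

Lemma chain_ext_step_linear (V : lmodType k) n (b c a : orbits C) (x : orbit_pt a)
    (F : forall y : orbit_pt b, chain n.+1 (val y) (val x) -> V)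
    (q : chain (C := CG) n (b : CG) (c : CG)) :
  chain_ext_linear_at V n -> (forall y, multilinear (F y)) ->
  forall r : pair_index c a, linear (chain_ext_step F q (r := r)).
Proof.
move=> EL FM r u f g; have [s sx] := transporter r.2 x.
rewrite !(chain_ext_stepE _ _ _ (erefl : _ = val (pt_act s r.1)) sx).
rewrite -EL => [|y|y]; try exact: (FM _ _).2.
congr (chain_ext _ q); apply: functional_extensionality_dep => y.
apply: functional_extensionality_dep => t.
by rewrite translate_linear (FM y _).1.
Qed.

Lemma chain_ext_linear (V : lmodType k) n : chain_ext_linear_at V n.
Proof.
elim: n => [|n IH] b a x u F F' FM FM'; first by [].
case=> c [q f]; rewrite -[existT _ _ _]/(@snoc k CG n b c a q f) !chain_ext_snoc.
have FFM y : multilinear (fun t => u *: F y t + F' y t) by apply: multilinearP.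
have A := chain_ext_step_act.
have L := qmor_ext_linear (chain_ext_step_linear q IH FM) (A _ _ _ _ _ _ F q).
have L' := qmor_ext_linear (chain_ext_step_linear q IH FM') (A _ _ _ _ _ _ F' q).
have LL := qmor_ext_linear (chain_ext_step_linear q IH FFM) (A _ _ _ _ _ _ _ q).
elim/qmor_ind: f => [|f g Hf Hg|r h].
- by rewrite (linear_fun0 L) (linear_fun0 L') (linear_fun0 LL) scaler0 addr0.
- by rewrite (linear_funD L) (linear_funD L') (linear_funD LL) Hf Hg scalerDr addrACA.
- have [s sx] := transporter r.2 x.
  rewrite !qmor_ext_class; try exact: chain_ext_step_linear; try exact: A.
  rewrite !(chain_ext_stepE _ _ _ (erefl : _ = val (pt_act s r.1)) sx).
  by rewrite -IH => // y; [apply: (FM _ _).2|apply: (FM' _ _).2].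
Qed.

Lemma chain_ext_class (V : lmodType k) n (b c a : orbits C) (x : orbit_pt a)
    (F : forall y : orbit_pt b, chain n.+1 (val y) (val x) -> V)
    (q : chain (C := CG) n (b : CG) (c : CG)) (r : pair_index c a)
    (h : mor (val r.1) (val r.2)) s (z : orbit_pt c)
    (sz : gob s (val r.1) = val z) (sx : gob s (val r.2) = val x) :
  (forall y, multilinear (F y)) ->
  chain_ext F (snoc q (mor_class h : mor (c : CG) (a : CG))) =
  chain_ext (x := z) (fun y t => F y (snoc t (translate sz sx h))) q.
Proof.
move=> FM; rewrite chain_ext_snoc -chain_ext_stepE.
apply: qmor_ext_class; last exact: chain_ext_step_act.
exact: (chain_ext_step_linear q (@chain_ext_linear V n) FM).
Qed.

Lemma chain_ext_multilinear (V : lmodType k) n (b a : orbits C) (x : orbit_pt a)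
    (F : forall y : orbit_pt b, chain n (val y) (val x) -> V) :
  (forall y, multilinear (F y)) -> multilinear (chain_ext F).
Proof.
elim: n a x F => [|n IH] a x F FM; first by [].
have L c (q : chain (C := CG) n (b : CG) (c : CG)) :
    linear (fun f : mor (c : CG) (a : CG) => chain_ext F (snoc q f)).
  apply: qmor_ext_linear; last exact: chain_ext_step_act.
  exact: (chain_ext_step_linear q (@chain_ext_linear V n) FM).
move=> c; split=> // f; elim/qmor_ind: f => [|f g Hf Hg|r h].
- apply: eq_multilinear (multilinear0 _ _ _ _) => q.
  by rewrite (linear_fun0 (L c q)).
- apply: eq_multilinear (multilinearP 1 Hf Hg) => q.
  by rewrite (linear_funD (L c q)) scale1r.
- have [s sx] := transporter r.2 x.
  have FM' y := (FM y (val (pt_act s r.1))).2 (translate erefl sx h).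
  apply: eq_multilinear (IH _ (pt_act s r.1) _ FM') => q.
  by rewrite (@chain_ext_class _ _ _ _ _ _ F q r h s (pt_act s r.1) erefl sx).
Qed.

(** The chain of C that starts at x' and has the same image as p is the translate
of p. *)
Lemma chain_ext_galois (V : lmodType k) n (y x : C) (x' : orbit_pt (orb x))
    (F : forall z : orbit_pt (orb y), chain n (val z) (val x') -> V)
    (p : chain n y x) s (sx : gob s x = val x') :
  (forall z, multilinear (F z)) ->
  chain_ext F (proj p) =
  F (pt_act s (pt y)) (chain_translate (erefl (gob s y)) sx p).
Proof.
elim: n x x' F p sx => [|n IH] x x' F p sx FM.
  case: x / p x' F sx FM => x' F sx _.
  have x'E : pt_act s (pt y) = x' by apply: val_inj.
  by case: _ / x'E F sx => F sx /=; congr F; apply: eq_irrelevance.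
case: p => z [q f].
rewrite [proj _]/(snoc _ _).
rewrite (@chain_ext_class _ _ _ _ _ _ _ _ (pt z, pt x) _ s (pt_act s (pt z)) erefl sx) //.
rewrite (IH z (pt_act s (pt z)) _ q erefl) => [|t]; last exact: (FM _ _).2.
by rewrite -[existT _ _ _]/(@snoc k C n y z x q f) (chain_translate_snoc _ (erefl _)).
Qed.

(** * From invariant cochains of C to cochains of C/G *)

Lemma mor_class_ev_multilinear n (phi : cochain C n) (b a : orbits C)
    (y : orbit_pt b) (x : orbit_pt a) :
  multilinear (fun t : chain n (val y) (val x) =>
    @mor_class k G C b a (y, x) (ev phi t)).
Proof.
exact: (multilinear_comp (@mor_class_linear _ _ _ _ _ (y, x)) (@ev_multilinear _ _ _ phi _ _)).
Qed.

(** The base point above the source of the chain is an arbitrary representative;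
for invariant cochains the choice is immaterial, see [descendE]. *)
Definition descend_fun n (phi : cochain C n) : chain_fun CG n := fun ba p =>
  chain_ext (x := orbit_repr ba.2)
    (fun y t => @mor_class k G C ba.1 ba.2 (y, orbit_repr ba.2) (ev phi t)) p.

Fact descend_subproof n (phi : cochain C n) : descend_fun phi \in @cochain_pred k CG n.
Proof.
apply/asboolP => b a; apply: chain_ext_multilinear => y.
exact: mor_class_ev_multilinear.
Qed.

Definition descend n (phi : cochain C n) : cochain CG n :=
  Sub (descend_fun phi) (descend_subproof phi).

(** If s moves x to the base point, the extension evaluates phi at the translate
of p by s.  By invariance this is the translate of phi(p), which has the same
class as phi(p). *)
Lemma descendE n (phi : cochain C n) (y x : C) (p : chain n y x) :
  (forall s, cochain_act s phi = phi) ->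
  ev (descend phi) (proj p) = galois_mor Cfree (ev phi p).
Proof.
move=> inv_phi; have [s sx] := transporter (pt x) (orbit_repr (orb x)).
have -> : ev (descend phi) (proj p) = chain_ext (x := orbit_repr (orb x))
    (fun z t => @mor_class k G C _ _ (z, orbit_repr (orb x)) (ev phi t)) (proj p) by [].
rewrite (chain_ext_galois p sx) => [|z]; last first.
  exact: mor_class_ev_multilinear.
rewrite -[X in ev X _](inv_phi s) cochain_act_translate.
exact: (@mor_class_translate _ _ _ _ _ s (pt y, pt x) (pt_act s (pt y), orbit_repr (orb x))).
Qed.

(** Every term of the coboundary is compatible with the functor C -> C/G. *)
Lemma galois_mor_cobound n (phi : cochain C n) (psi : cochain CG n) :
  (forall y x (p : chain n y x), ev psi (proj p) = galois_mor Cfree (ev phi p)) ->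
  forall y x (p : chain n.+1 y x),
    ev (cobound psi) (proj p) = galois_mor Cfree (ev (cobound phi) p).
Proof.
move=> psiE y x [w [r f]]; rewrite -[existT _ _ _]/(@snoc k C n y w x r f).
have := split_last_galois (snoc r f).
case E: (split_last (snoc r f)) => [z [g q]]; rewrite galois_chain_snoc => E'.
rewrite (ev_cobound_snoc phi E) (ev_cobound_snoc psi E') -galois_chain_snoc.
have L := @galois_mor_linear k G C Cfree y x.
rewrite !(linear_funD L) (linear_fun_sum L) (linear_funZ L) !galois_mor_comp !psiE.
congr (_ + _ + _); apply: eq_bigr => i _.
by rewrite contract_galois (linear_funZ L) psiE.
Qed.

Lemma descend_cobound n (phi : cochain C n) :
  (forall s, cochain_act s phi = phi) ->
  cobound (descend phi) = descend (cobound phi).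
Proof.
move=> inv_phi; apply: cochain_galois_ext => y x p.
rewrite (galois_mor_cobound (fun _ _ _ => descendE _ inv_phi)) descendE //.
by move=> s; rewrite -cobound_act inv_phi.
Qed.

Lemma descend0 n : descend (0 : cochain C n) = 0.
Proof.
apply: cochain_galois_ext => y x p.
rewrite descendE => [|s]; last exact: (linear_fun0 (@cochain_act_linear _ _ _ s n)).
exact: (linear_fun0 (@galois_mor_linear _ _ _ Cfree y x)).
Qed.

Lemma descend_linear n u (phi phi' : cochain C n) :
  (forall s, cochain_act s phi = phi) -> (forall s, cochain_act s phi' = phi') ->
  descend (u *: phi + phi') = u *: descend phi + descend phi'.
Proof.
move=> I I'; apply: cochain_galois_ext => y x p.
rewrite evP !descendE // => [|s]; last by rewrite cochain_act_linear I I'.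
by rewrite evP galois_mor_linear.
Qed.

Lemma descendB n (phi phi' : cochain C n) :
  (forall s, cochain_act s phi = phi) -> (forall s, cochain_act s phi' = phi') ->
  descend (phi - phi') = descend phi - descend phi'.
Proof.
move=> I I'; rewrite [phi - phi']addrC -[- phi']scaleN1r descend_linear //.
by rewrite scaleN1r addrC.
Qed.

(** * From cochains of C/G to invariant cochains of C *)

Lemma component_neq_source (y x : C) (x' : orbit_pt (orb x)) (f : mor y (val x')) :
  val x' != x ->
  component (@mor_class k G C _ _ (pt y, x') f : mor (orb y : CG) (orb x : CG)) = 0.
Proof.
move=> xx'; rewrite component_class component_at0 // => -[s [/= /Cfree s1 sx]].
by case/eqP: xx'; rewrite -[RHS]sx s1 gob1.
Qed.

(** Let u be the class of f, with f translated so as to end at y.  If f starts at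
x, both sides are the composite in C.  Otherwise f starts at another point of the
orbit of x; so does the composite of g and f, and both components vanish. *)
Lemma component_comp_l (z y x : C) (g : mor z y) (u : mor (orb y : CG) (orb x : CG)) :
  component (mcomp (galois_mor Cfree g) u) = mcomp g (component u).
Proof.
have K w := @component_linear k G C Cfree w x; have M := @mcomp_linear_r k.
elim/qmor_ind: u => [|u u' Hu Hu'|[y' x'] f].
- by rewrite (linear_fun0 (M CG _ _ _ _)) !(linear_fun0 (K _)) (linear_fun0 (M C _ _ _ _)).
- rewrite (linear_funD (M CG _ _ _ _)) !(linear_funD (K _)) Hu Hu'.
  by rewrite (linear_funD (M C _ _ _ _)).
have [s sy] := transporter y' (pt y).
rewrite -(@mor_class_translate _ _ _ _ _ s (y', x') (pt y, pt_act s x') sy erefl).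
move: (pt_act s x') (translate _ _ _) => {sy f}x' f.
have [xx'|xx'] := eqVneq (val x') x.
  have e : pt x = x' by apply: val_inj.
  case: _ / e f => f; rewrite -/(galois_mor Cfree f).
  by rewrite -galois_mor_comp !component_galois_mor.
rewrite (@component_neq_source y x x' f xx') (linear_fun0 (M C _ _ _ _)).
rewrite [mcomp _ _](@qcomp_class _ _ _ Cfree _ _ _ (pt z, pt y) (pt y, x')
  g f 1%g x' (gob1 _) (gob1 _)).
exact: component_neq_source.
Qed.

(** The mirror image of [component_comp_l]: here it is the target of the morphism
representing u that may differ from z. *)
Lemma component_comp_r (z y x : C) (u : mor (orb z : CG) (orb y : CG)) (f : mor y x) :
  component (mcomp u (galois_mor Cfree f)) = mcomp (component u) f.
Proof.
have K w := @component_linear k G C Cfree z w; have M := @mcomp_linear_l k.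
elim/qmor_ind: u => [|u u' Hu Hu'|[z' y'] g].
- by rewrite (linear_fun0 (M CG _ _ _ _)) !(linear_fun0 (K _)) (linear_fun0 (M C _ _ _ _)).
- rewrite (linear_funD (M CG _ _ _ _)) !(linear_funD (K _)) Hu Hu'.
  by rewrite (linear_funD (M C _ _ _ _)).
have [s sy] := transporter y' (pt y).
rewrite -(@mor_class_translate _ _ _ _ _ s (z', y') (pt_act s z', pt y) erefl sy).
move: (pt_act s z') (translate _ _ _) => {sy g}z' g.
have [zz'|zz'] := eqVneq (val z') z.
  have e : pt z = z' by apply: val_inj.
  case: _ / e g => g; rewrite -/(galois_mor Cfree g).
  by rewrite -galois_mor_comp !component_galois_mor.
rewrite (@component_neq _ _ _ Cfree z y z' g zz') (linear_fun0 (M C _ _ _ _)).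
rewrite [mcomp _ _](@qcomp_class _ _ _ Cfree _ _ _ (z', pt y) (pt y, pt x)
  g f 1%g (pt x) (gob1 _) (gob1 _)).
exact: component_neq.
Qed.

(** The spaces of morphisms of C/G between the orbits of sx and sy and between
those of x and y coincide; the component along (sy, sx) is the translate of the
component along (y, x). *)
Lemma component_gob s (y x : C)
    (u : mor (orb (gob s y) : CG) (orb (gob s x) : CG)) :
  component u =
  ghom s (component (hcast (orb_gob s y : _ = _ :> CG) (orb_gob s x : _ = _ :> CG) u)).
Proof.
have K := @component_linear k G C Cfree; have H := ghom_linear.
have HC := @hcast_linear k CG.
elim/qmor_ind: u => [|u u' Hu Hu'|r f].
- by rewrite (linear_fun0 (HC _ _ _ _ _ _)) !(linear_fun0 (K _ _)) (linear_fun0 (H _ _ _ _ _ _)).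
- rewrite (linear_funD (HC _ _ _ _ _ _)) !(linear_funD (K _ _)) Hu Hu'.
  by rewrite (linear_funD (H _ _ _ _ _ _)).
have [t tx] := transporter r.2 (pt (gob s x)).
have cx : gob (s^-1 * t)%g (val r.2) = x by rewrite gobM tx gobK.
have [ty|ty] := eqVneq (gob t (val r.1)) (gob s y).
  have cy : gob (s^-1 * t)%g (val r.1) = y by rewrite gobM ty gobK.
  rewrite component_class (component_atE Cfree ty tx).
  rewrite (@hcast_mor_class _ _ _ _ _ _ _ (pt y, pt x) _ cy cx) component_galois_mor.
  rewrite -translate_erefl; have e : (s * (s^-1 * t))%g = t by rewrite mulgA mulgV mul1g.
  have [sty stx] : gob (s * (s^-1 * t))%g (val r.1) = gob s y
      /\ gob (s * (s^-1 * t))%g (val r.2) = gob s x by rewrite e.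
  by rewrite (translateM _ _ _ _ sty stx); apply: translate_eq.
(* The morphism starting at sx that has the class of f ends at another point than
   sy, and the one starting at x ends at y0, another point than y: both components
   vanish. *)
have y0P : orb (gob (s^-1 * t)%g (val r.1)) == orb y.
  by rewrite orb_gob (eqP (valP r.1)) orb_gob.
pose y0 : orbit_pt (orb y) := exist (fun z => is_true (orb z == orb y)) _ y0P.
rewrite (@hcast_mor_class _ _ _ _ _ _ _ (y0, pt x) _ erefl cx).
rewrite -(@mor_class_translate _ _ _ _ _ t r (pt_act t r.1, pt (gob s x)) erefl tx).
rewrite (@component_neq _ _ _ Cfree _ _ (pt_act t r.1) _ ty).
rewrite component_neq ?(linear_fun0 (H _ _ _ _ _ _)) //=.
by apply: contra_neq ty => cy; rewrite -[in RHS]cy -gobM mulgA mulgV mul1g.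
Qed.

Definition restrict_fun n (psi : cochain CG n) : chain_fun C n := fun yx p =>
  component (ev psi (proj p)).

Lemma multilinear_galois_chain (V : lmodType k) n (y x : C)
    (F : chain (C := CG) n (orb y : CG) (orb x : CG) -> V) :
  multilinear F -> multilinear (fun p : chain n y x => F (proj p)).
Proof.
elim: n x F => [|n IH] x F // /multilinearS FM; apply/multilinearS => z.
split=> [q a u v|f]; last exact: (IH z _ ((FM _).2 _)).
by rewrite !galois_chain_snoc galois_mor_linear (FM _).1.
Qed.

Fact restrict_subproof n (psi : cochain CG n) : restrict_fun psi \in @cochain_pred k C n.
Proof.
apply/asboolP => y x.
apply: (multilinear_comp (@component_linear k G C Cfree y x)).
exact/multilinear_galois_chain/ev_multilinear.
Qed.

Definition restrict n (psi : cochain CG n) : cochain C n :=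
  Sub (restrict_fun psi) (restrict_subproof psi).

Lemma restrictE n (psi : cochain CG n) (y x : C) (p : chain n y x) :
  ev (restrict psi) p = component (ev psi (proj p)).
Proof. by []. Qed.

Lemma restrict_inv n (psi : cochain CG n) s : cochain_act s (restrict psi) = restrict psi.
Proof.
apply: (cochain_act_ext (s := s)) => y x p.
by rewrite cochain_actE !restrictE component_gob -ev_chain_cast galois_chain_act.
Qed.

Lemma restrict_linear n : linear (@restrict n).
Proof.
by move=> a u v; apply: cochainP => y x p; rewrite evP !restrictE evP component_linear.
Qed.

Lemma restrict_cobound n (psi : cochain CG n) :
  cobound (restrict psi) = restrict (cobound psi).
Proof.
apply: cochainP => y x [w [r f]]; rewrite -[existT _ _ _]/(@snoc k C n y w x r f).
have := split_last_galois (snoc r f).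
case E: (split_last (snoc r f)) => [z [g q]]; rewrite restrictE galois_chain_snoc => E'.
rewrite (ev_cobound_snoc _ E) (ev_cobound_snoc psi E') -galois_chain_snoc.
have L := @component_linear k G C Cfree y x.
rewrite !(linear_funD L) (linear_fun_sum L) (linear_funZ L) component_comp_l component_comp_r.
rewrite !restrictE; congr (_ + _ + _); apply: eq_bigr => i _.
by rewrite contract_galois (linear_funZ L).
Qed.

Lemma restrict_descend n (phi : cochain C n) :
  (forall s, cochain_act s phi = phi) -> restrict (descend phi) = phi.
Proof.
move=> inv_phi; apply: cochainP => y x p.
by rewrite restrictE descendE // component_galois_mor.
Qed.

End Galois.

(** * Invariant classes and invariant cocycles *)

Section Cohomology.
Variables (k : fieldType) (D : kcat k).

Lemma HH_class_eq n (phi psi : cocycle D n) :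
  HH_class phi = HH_class psi <-> cobound_image (val phi - val psi).
Proof.
have E : val (phi - psi) = val phi - val psi.
  by rewrite addrC -scaleN1r (subspace_valP (-1) psi phi) scaleN1r addrC.
rewrite -E; split=> [/cls_eq|h]; first by rewrite unfold_in => /asboolP.
by apply/cls_eq; rewrite unfold_in; apply/asboolP.
Qed.

Lemma HH_class_linear n : linear (@HH_class k D n).
Proof. exact: cls_linear. Qed.

Lemma HH_classK n (h : HH D n) : HH_class (repr h) = h.
Proof. exact: clsK. Qed.

End Cohomology.

Section Invariants.
Variables (k : fieldType) (G : groupType) (C : gkcat k G).
Hypothesis invG_exact : invariants_exact k G.

HB.instance Definition _ n :=
  GRing.isLinear.Build k (cocycle_gmodule C n) (HH_gmodule C n) *:%R (@HH_class k C n)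
    (@HH_class_linear k C n).
HB.instance Definition _ n :=
  GRing.isLinear.Build k (cochain_gmodule C n) (cochain_gmodule C n.+1) *:%R
    (@cobound k C n) (@cobound_linear k C n).

Lemma invariantP (M : gmodule k G) (m : invariants M) s : gmod_act s (val m) = val m.
Proof. by case: m => m /= /asboolP. Qed.

Definition invariant (M : gmodule k G) (m : M) (inv_m : forall s, gmod_act s m = m) :
  invariants M := Sub m (asboolT inv_m).

Lemma invariant_class (n : nat) (h : invariants (HH_gmodule C n)) :
  exists phi : invariants (cocycle_gmodule C n), val h = HH_class (val phi).
Proof.
pose g : {linear cocycle_gmodule C n -> HH_gmodule C n} := @HH_class k C n.
have gG : equivariant g by move=> s m; apply/esym/HH_actE.
have [|phi phiI gphi] := invariant_lift gG (m := repr (val h)) invG_exact.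
  by move=> s; rewrite [g _]HH_classK invariantP.
by exists (invariant phiI); rewrite -[LHS]HH_classK -[LHS]gphi.
Qed.

Lemma invariant_coboundary n (chi : cochain C n) :
  (forall s, cochain_act s (cobound chi) = cobound chi) ->
  exists2 chi' : cochain C n,
    (forall s, cochain_act s chi' = chi') & cobound chi' = cobound chi.
Proof.
pose g : {linear cochain_gmodule C n -> cochain_gmodule C n.+1} := @cobound k C n.
have gG : equivariant g by move=> s m; apply: cobound_act.
by move=> I; have [] := invariant_lift gG (m := chi) invG_exact I => chi'; exists chi'.
Qed.

End Invariants.

(** * The inclusion and its retraction *)

Section Splitting.
Variables (k : fieldType) (G : groupType) (C : gkcat k G) (Cfree : free_action C).
Hypothesis invG_exact : invariants_exact k G.
Local Notation CG := (quotient_kcat Cfree).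

Lemma cocycle_inv n (phi : invariants (cocycle_gmodule C n)) s :
  cochain_act s (val (val phi)) = val (val phi).
Proof. exact: (congr1 val (invariantP phi s)). Qed.

Fact descend_cocycle_subproof n (phi : invariants (cocycle_gmodule C n)) :
  descend Cfree (val (val phi)) \in @cocycle_pred k CG n.
Proof.
apply/eqP; rewrite descend_cobound; last exact: cocycle_inv.
by rewrite (eqP (valP (val phi))) descend0.
Qed.

Definition descend_cocycle n (phi : invariants (cocycle_gmodule C n)) : cocycle CG n :=
  Sub (descend Cfree (val (val phi))) (descend_cocycle_subproof phi).

Fact restrict_cocycle_subproof n (psi : cocycle CG n) :
  restrict (val psi) \in @cocycle_pred k C n.
Proof.
apply/eqP; rewrite restrict_cobound (eqP (valP psi)).
exact: (linear_fun0 (@restrict_linear _ _ _ Cfree n.+1)).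
Qed.

Definition restrict_cocycle n (psi : cocycle CG n) : cocycle C n :=
  Sub (restrict (val psi)) (restrict_cocycle_subproof psi).

Fact restrict_cocycle_inv n (psi : cocycle CG n) s :
  gmod_act (g := cocycle_gmodule C n) s (restrict_cocycle psi) = restrict_cocycle psi.
Proof. by apply: val_inj; apply: restrict_inv. Qed.

(** Here invariant coboundaries have to bound invariant cochains: only
those descend to C/G. *)
Lemma descend_cobound_image n (chi : cochain C n) :
  (forall s, cochain_act s chi = chi) -> cobound_image chi ->
  cobound_image (descend Cfree chi).
Proof.
case: n chi => [|n] chi inv_chi; first by move=> ->; apply: descend0.
move=> [eta etaE].
have [|eta' inv_eta' eta'E] := invariant_coboundary invG_exact (chi := eta).
  by move=> s; rewrite -etaE.
by exists (descend Cfree eta'); rewrite descend_cobound // eta'E etaE.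
Qed.

Lemma restrict_cobound_image n (chi : cochain CG n) :
  cobound_image chi -> cobound_image (restrict chi).
Proof.
case: n chi => [|n] chi.
  by move=> ->; apply: (linear_fun0 (@restrict_linear _ _ _ Cfree 0)).
by move=> [eta ->]; exists (restrict eta); rewrite restrict_cobound.
Qed.

Lemma HH_class_descend n (phi phi' : invariants (cocycle_gmodule C n)) :
  HH_class (val phi) = HH_class (val phi') ->
  HH_class (descend_cocycle phi) = HH_class (descend_cocycle phi').
Proof.
move=> /HH_class_eq h; apply/HH_class_eq.
have -> : val (descend_cocycle phi) - val (descend_cocycle phi')
    = descend Cfree (val (val phi) - val (val phi')).
  by rewrite descendB //; apply: cocycle_inv.
apply: descend_cobound_image h => s.
by rewrite (linear_funB (@cochain_act_linear _ _ _ s n)) !cocycle_inv.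
Qed.

Lemma HH_class_restrict n (psi psi' : cocycle CG n) :
  HH_class psi = HH_class psi' ->
  HH_class (restrict_cocycle psi) = HH_class (restrict_cocycle psi').
Proof.
move=> /HH_class_eq h; apply/HH_class_eq.
have -> : val (restrict_cocycle psi) - val (restrict_cocycle psi')
    = restrict (val psi - val psi').
  by rewrite (linear_funB (@restrict_linear _ _ _ Cfree n)).
exact: restrict_cobound_image.
Qed.

Definition galois_incl n (h : invariants (HH_gmodule C n)) : HH CG n :=
  HH_class (descend_cocycle (sval (cid (invariant_class invG_exact h)))).

Lemma galois_inclE n (h : invariants (HH_gmodule C n))
    (phi : invariants (cocycle_gmodule C n)) :
  val h = HH_class (val phi) -> galois_incl h = HH_class (descend_cocycle phi).
Proof.
move=> hphi; rewrite /galois_incl; case: cid => phi' /= hphi'.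
by apply: HH_class_descend; rewrite -hphi'.
Qed.

Fact galois_incl_linear n : linear (@galois_incl n).
Proof.
move=> a h h'.
have [phi hE] := invariant_class invG_exact h.
have [phi' hE'] := invariant_class invG_exact h'.
have E : val (a *: h + h') = HH_class (val (a *: phi + phi')).
  rewrite (subspace_valP a h h') hE hE' (subspace_valP a phi phi').
  by rewrite (@HH_class_linear k C n).
rewrite (galois_inclE hE) (galois_inclE hE') (galois_inclE E).
rewrite -(@HH_class_linear k CG n); congr (HH_class _); apply: val_inj.
rewrite (subspace_valP a (descend_cocycle phi) (descend_cocycle phi')) /=.
by rewrite -descend_linear; try exact: cocycle_inv.
Qed.
HB.instance Definition _ n :=
  GRing.isLinear.Build k (invariants (HH_gmodule C n)) (HH CG n) *:%R
    (@galois_incl n) (@galois_incl_linear n).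

Fact galois_retr_inv n (psi : cocycle CG n) s :
  gmod_act (g := HH_gmodule C n) s (HH_class (restrict_cocycle psi))
  = HH_class (restrict_cocycle psi).
Proof. by rewrite [LHS]HH_actE; congr (HH_class _); apply: restrict_cocycle_inv. Qed.

Definition galois_retr n (u : HH CG n) : invariants (HH_gmodule C n) :=
  invariant (galois_retr_inv (repr u)).

Lemma galois_retrE n (psi : cocycle CG n) :
  val (galois_retr (HH_class psi)) = HH_class (restrict_cocycle psi).
Proof. by apply: HH_class_restrict; apply: HH_classK. Qed.

Fact galois_retr_linear n : linear (@galois_retr n).
Proof.
move=> a u u'; rewrite -(HH_classK u) -(HH_classK u') -(@HH_class_linear k CG n).
move: (repr u) (repr u') => psi psi'; apply: val_inj.
rewrite [RHS](subspace_valP a (galois_retr (HH_class psi)) (galois_retr (HH_class psi'))).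
rewrite !galois_retrE -(@HH_class_linear k C n); congr (HH_class _); apply: val_inj.
by rewrite (subspace_valP a (restrict_cocycle psi) (restrict_cocycle psi')) /= restrict_linear.
Qed.
HB.instance Definition _ n :=
  GRing.isLinear.Build k (HH CG n) (invariants (HH_gmodule C n)) *:%R
    (@galois_retr n) (@galois_retr_linear n).

Lemma galois_inclK n : cancel (@galois_incl n) (@galois_retr n).
Proof.
move=> h; have [phi hE] := invariant_class invG_exact h.
apply: val_inj; rewrite (galois_inclE hE) galois_retrE hE; congr (HH_class _).
by apply: val_inj; apply: restrict_descend; apply: cocycle_inv.
Qed.

End Splitting.

Theorem corollary4p11 (k : fieldType) (G : groupType) (C : gkcat k G)
    (Cfree : free_action C) (invG_exact : invariants_exact k G) :
  exists (iota : forall n : nat,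
            {linear invariants (HH_gmodule C n) -> HH (quotient_kcat Cfree) n})
         (rho : forall n : nat,
            {linear HH (quotient_kcat Cfree) n -> invariants (HH_gmodule C n)}),
    [/\ (forall n : nat, injective (iota n)),
        (forall n : nat, cancel (iota n) (rho n)),
        canonical_inclusion (fun n => iota n) &
        canonical_retraction (fun n => rho n)].
Proof.
exists (fun n => @galois_incl k G C Cfree invG_exact n), (fun n => @galois_retr k G C Cfree n).
have iotaK := galois_inclK Cfree invG_exact.
split=> [n|//|n|n psi]; first exact: can_inj (iotaK n).
- split=> [h|h phi hE]; first exact: invariant_class.
  exists (descend_cocycle Cfree phi); last exact: galois_inclE.
  by move=> y x p; apply: descendE; apply: cocycle_inv.
- by exists (invariant (restrict_cocycle_inv psi)) => //; apply: galois_retrE.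
Qed.
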